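(* Let $H$ be a complex Hilbert space. Let $A$ be an unbounded closed and symmetric operator in $H$ with domain $D(A)$, and let $B\in B(H)$ be positive. If $AB$ is normal, then $BA\subset AB$, and so $AB$ is self-adjoint. Also, $\overline{BA}$ is self-adjoint. Besides, $B|A|\subset |A|B$, and so $|A|B$ is self-adjoint and positive. Moreover, $|A|B=\overline{B|A|}$.
   Context: Operators are linear and defined on a linear subspace (the domain) of the complex Hilbert space $H$; ''unbounded'' means not assumed to be bounded or everywhere defined. $B(H)$ is the algebra of bounded, everywhere defined linear operators on $H$. $S\subset T$ means $D(S)\subset D(T)$ and $S=T$ on $D(S)$. The product $ST$ has domain $D(ST)=\{x\in D(T): Tx\in D(S)\}$. $\overline{T}$ denotes the closure of a closable operator $T$ (the smallest closed extension). A densely defined operator $T$ is symmetric if $T\subset T^*$, self-adjoint if $T=T^*$, and normal if it is closed and $TT^*=T^*T$ (equality of domains included). A symmetric operator $T$ is positive if $\langle Tx,x\rangle\ge 0$ for all $x\in D(T)$. For a densely defined closed operator $A$, $|A|$ denotes the unique positive self-adjoint square root of the positive self-adjoint operator $A^*A$. *)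

(* Defs.v *)
From HB Require Import structures.
From mathcomp Require Import all_boot all_order all_algebra.
From mathcomp Require Import sesquilinear complex.
From mathcomp Require Import boolp classical_sets reals topology normedtype.

Set Implicit Arguments.
Unset Strict Implicit.
Unset Printing Implicit Defensive.

Import Order.TTheory GRing.Theory Num.Theory.
Import numFieldNormedType.Exports.

Local Open Scope classical_set_scope.
Local Open Scope complex_scope.
Local Open Scope ring_scope.

(* [{dot H for Num.conj}] is linear in its first argument and conjugate-linear
   in its second one. *)
HB.mixin Record CompleteNormedModule_isHilbert (R : realType) H
    & CompleteNormedModule R[i] H := {
  inner : {dot H for @Num.conj R[i]} ;
  sqr_norm_inner : forall x : H, `|x| ^+ 2 = inner x x
}.

#[short(type="hilbertType")]
HB.structure Definition Hilbert (R : realType) :=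
  {H of CompleteNormedModule R[i] H & CompleteNormedModule_isHilbert R H}.

Notation "''[' x , y ]" := (inner x y) : ring_scope.

Section Operators.
Variables (R : realType) (H : hilbertType R).

(* A partially defined map is identified with its graph: [T (x, y)] means that
   x lies in D(T) and T x = y.  Equality of operators is thus equality of sets,
   and the extension relation S ⊂ T is [S `<=` T] (see [op_subP]). *)
Implicit Types S T P : set (H * H).

Definition dom T : set H := [set x | exists y, T (x, y)].

Definition is_operator T : Prop :=
  [/\ forall x y z, T (x, y) -> T (x, z) -> y = z,
      T (0, 0) &
      forall (a : R[i]) x y x' y',
        T (x, y) -> T (x', y') -> T (a *: x + x', a *: y + y')].

Lemma op_subP S T : is_operator S -> is_operator T ->
  S `<=` T <-> (dom S `<=` dom T /\
                forall x y z, S (x, y) -> T (x, z) -> y = z).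
Proof.
move=> _ [funT _ _]; split=> [ST | [domST eqST] [x y] Sxy].
  split=> [x [y /ST Txy] | x y z /ST]; first by exists y.
  exact: funT.
have [|z Txz] := domST x; first by exists y.
by rewrite (eqST _ _ _ Sxy Txz).
Qed.

(* The graph of an everywhere defined map. *)
Definition graph (f : H -> H) : set (H * H) := [set p | p.2 = f p.1].

Definition op_comp S T : set (H * H) :=
  [set p | exists2 y, T (p.1, y) & S (y, p.2)].

Local Notation "S *o T" := (op_comp S T) (at level 40, left associativity).

Lemma dom_comp S T :
  dom (S *o T) = [set x | exists2 y, T (x, y) & dom S y].
Proof.
apply/seteqP; split=> x /=; first by move=> [z [y Txy Syz]]; exists y; last exists z.
by move=> [y Txy [z Syz]]; exists z, y.
Qed.

Definition densely_defined T : Prop := dense (dom T).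

(* This is the graph of an operator only when T is densely defined. *)
Definition adjoint T : set (H * H) :=
  [set p | forall x y, T (x, y) -> '[y, p.1] = '[x, p.2]].

Definition closed_operator T : Prop := is_operator T /\ closed T.

(* The intersection of (the graphs of) all closed extensions of T: for closable
   T it is the smallest closed extension, otherwise it is [setT], which is not
   the graph of an operator. *)
Definition op_closure T : set (H * H) := smallest closed_operator T.

Definition symmetric_operator T : Prop :=
  [/\ is_operator T, densely_defined T & T `<=` adjoint T].

Definition self_adjoint T : Prop :=
  [/\ is_operator T, densely_defined T & T = adjoint T].

Definition normal_operator T : Prop :=
  [/\ densely_defined T, closed_operator T &
      T *o adjoint T = adjoint T *o T].

(* In [R[i]], [0 <= z] says that z is real and nonnegative. *)
Definition positive_operator T : Prop :=
  symmetric_operator T /\ forall x y, T (x, y) -> 0 <= '[y, x].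

Definition bounded_operator (f : {linear H -> H}) : Prop :=
  exists M : R[i], forall x, `|f x| <= M * `|x|.

(* The unique positive self-adjoint square root of A^* A, picked by choice. *)
Definition abs_op A : set (H * H) :=
  xget set0 [set P | [/\ self_adjoint P, positive_operator P &
                         P *o P = adjoint A *o A]].

End Operators.

Arguments graph {R H} f.

Notation "S *o T" := (op_comp S T)
  (at level 40, left associativity, format "S  *o  T").

(* Main.v *)
Require Import Defs.
From mathcomp Require Import all_boot all_algebra classical_sets reals.
From mathcomp Require Import all_order sesquilinear complex ring lra.
From mathcomp Require Import boolp topology normedtype.

(* Write N = AB.  Since A is symmetric, <Nx, Bx> is real, so the form <Bx, x> takes
   the same value at (N + i)x and (N - i)x.  On a spectral subspace of N inside
   the open upper half plane the Cayley transform is a strict contraction, so the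
   form vanishes there; then N = AB vanishes there too and the subspace is 0.  The
   same holds for the lower half plane, so N is self-adjoint, and BA is contained
   in (AB)^* = AB.  Spectral subspaces come from the bounded self-adjoint operator
   Im (N (1 + N^*N)^-1), using square roots of bounded positive operators.

   From BA contained in AB, B commutes with (1 + A^*A)^-1, hence with |A|.  Finally,
   for every closed densely defined T with BT contained in TB, the closure of BT is
   TB. *)

Set Implicit Arguments.
Unset Strict Implicit.
Unset Printing Implicit Defensive.

Import Order.TTheory GRing.Theory Num.Theory.
Import numFieldNormedType.Exports.

Local Open Scope classical_set_scope.
Local Open Scope complex_scope.
Local Open Scope ring_scope.

(** * The real inner product *)

Section RealForm.
Variables (R : realType) (H : hilbertType R).
Implicit Types (x y z : H) (r : R).

(** Symmetry of A places B N inside N^* B, the setting of the Fuglede-Putnam theorem. The positivity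
    of B allows a more elementary route: a positive form that is invariant under a strict
    contraction can be bounded by iteration, and a vector on which it vanishes is killed by B. No
    functional calculus enters. The spectral subspace W >= d is the kernel of |U| - U for U = W - d,
    and it is invariant under each bounded map commuting with W because the square root commutes
    with such maps.

    Unbounded operators are handled through the bounded maps R and Z attached to their graphs, and
    through orthogonal projections in H x H.

    All estimates use the real part of the inner product, so projections and square roots are
    developed for real-linear objects. Multiplication by i is kept as the map [imul], skew for
    [dotR]; complex identities return by testing against it. *)

Definition dotR x y : R := complex.Re '[x, y].
Definition imul x : H := 'i%C *: x.
Definition rscale (r : R) x : H := r%:C *: x.
Definition nrm x : R := complex.Re `|x|.

Lemma dotRC x y : dotR x y = dotR y x.
Proof.
have reJ (c : R[i]) : complex.Re (Num.conj c) = complex.Re c by case: c.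
by rewrite /dotR hermC expr0 mul1r; apply: reJ.
Qed.
Lemma dotRDl x y z : dotR (x + y) z = dotR x z + dotR y z.
Proof. by rewrite /dotR linearDl /= raddfD. Qed.
Lemma dotRNl x z : dotR (- x) z = - dotR x z.
Proof. by rewrite /dotR linearNl /= raddfN. Qed.
Lemma dotRZl r x z : dotR (rscale r x) z = r * dotR x z.
Proof.
by rewrite /dotR linearZl_LR /=; case: '[x, z] => a b /=; rewrite mul0r subr0.
Qed.
Lemma dotRDr x y z : dotR z (x + y) = dotR z x + dotR z y.
Proof. by rewrite dotRC dotRDl !(dotRC z). Qed.
Lemma dotRNr x z : dotR z (- x) = - dotR z x.
Proof. by rewrite dotRC dotRNl !(dotRC z). Qed.
Lemma dotRZr r x z : dotR z (rscale r x) = r * dotR z x.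
Proof. by rewrite dotRC dotRZl !(dotRC z). Qed.
Lemma dotRiC x y : dotR (imul x) y = - dotR x (imul y).
Proof.
rewrite /dotR !linearZl_LR /= linearZr_LR /=.
case: '[x, y] => a b /=. ring.
Qed.
Lemma imul_imul x : imul (imul x) = - x.
Proof. by rewrite /imul scalerA -expr2 sqr_i scaleN1r. Qed.
Lemma inner_dotR x y : '[x, y] = (dotR x y) +i* (dotR x (imul y)).
Proof.
rewrite /dotR /imul linearZr_LR /=. case: '[x, y] => a b /=.
by congr Complex; ring.
Qed.

Lemma dotR_nrm x : dotR x x = nrm x ^+ 2.
Proof.
rewrite /dotR -sqr_norm_inner /nrm.
have /ger0_Im : 0 <= `|x| by exact: normr_ge0.
by case: `|x| => a b /= ->; rewrite mulr0 subr0 expr2.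
Qed.
Lemma normE x : `|x| = (nrm x)%:C.
Proof.
have /ger0_Im := normr_ge0 x. rewrite /nrm.
by case: `|x| => a b /= ->.
Qed.
Lemma nrm_ge0 x : 0 <= nrm x.
Proof. by rewrite -ler0c -normE normr_ge0. Qed.
Lemma nrm0 : nrm 0 = 0. Proof. by rewrite /nrm normr0. Qed.
Lemma nrmN x : nrm (- x) = nrm x. Proof. by rewrite /nrm normrN. Qed.
Lemma nrm_eq0 x : nrm x = 0 -> x = 0.
Proof. by move=> h; apply/eqP; rewrite -normr_eq0 normE h. Qed.
Lemma nrmD x y : nrm (x + y) <= nrm x + nrm y.
Proof. by rewrite -lecR raddfD /= -!normE ler_normD. Qed.
Lemma nrm_rscale r x : nrm (rscale r x) = `|r| * nrm x.
Proof.
by rewrite /nrm /rscale normrZ normE normc_def /= expr0n /= addr0 sqrtr_sqr; ring.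
Qed.
Lemma nrm_imul x : nrm (imul x) = nrm x.
Proof.
by rewrite /nrm /imul normrZ normE normc_def /= expr0n /= add0r expr1n sqrtr1; ring.
Qed.
Lemma dotR_ge0 x : 0 <= dotR x x. Proof. by rewrite dotR_nrm sqr_ge0. Qed.
Lemma dotR_eq0 x : dotR x x = 0 -> x = 0.
Proof. by rewrite dotR_nrm => /eqP; rewrite sqrf_eq0 => /eqP /nrm_eq0. Qed.

Lemma nrm_le x y : dotR x x <= dotR y y -> nrm x <= nrm y.
Proof. by rewrite !dotR_nrm ler_sqr ?nnegrE ?nrm_ge0. Qed.

(** The norm belongs to the structure, so its triangle inequality is already available; squaring it
    gives the bound. *)
Lemma cauchy_schwarz x y : `|dotR x y| <= nrm x * nrm y.
Proof.
have q x' y' : dotR x' y' <= nrm x' * nrm y'.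
  have := nrmD x' y'; rewrite -ler_sqr ?nnegrE ?addr_ge0 ?nrm_ge0 //.
  rewrite -dotR_nrm !(dotRDl, dotRDr) !dotR_nrm (dotRC y') sqrrD. lra.
rewrite ler_norml q andbT. have := q (- x) y; rewrite dotRNl nrmN. lra.
Qed.
End RealForm.

(** * Closure, density and completeness with real radii *)

Section Topology.
Variables (R : realType) (H : hilbertType R).
Implicit Types (x y z : H) (r : R) (M : set (H * H)) (p : H * H).

Lemma gt0_realC (e : R[i]) : 0 < e -> exists2 r : R, 0 < r & e = r%:C.
Proof.
case: e => a b; rewrite ltcE /= => /andP[/eqP b0 a0]. 
by exists a => //; rewrite b0.
Qed.

Lemma ball_nrm x y (r : R) : ball x r%:C y <-> nrm (x - y) < r.
Proof. by rewrite -ball_normE /= normE ltcR. Qed.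

(** Balls of H have radii in [R[i]]; this is membership in the closure expressed with real radii,
    one estimate per component. *)
Definition adherent M p :=
  forall r : R, 0 < r -> exists2 q, M q & nrm (p.1 - q.1) < r /\ nrm (p.2 - q.2) < r.

Lemma closure_adherent M p : closure M p <-> adherent M p.
Proof.
split=> [clMp r r0 | adh U /nbhs_ballP[_ /gt0_realC[r r0 ->] rU]].
  have [|q [Mq [b1 b2]]] := clMp (ball p r%:C).
    by apply: nbhsx_ballx; rewrite ltcR.
  by exists q => //; split; apply/ball_nrm.
have [q Mq [q1 q2]] := adh r r0.
by exists q; split=> //; apply: rU; split; apply/ball_nrm.
Qed.

Lemma closed_adherent M : closed M <-> (forall p, adherent M p -> M p).
Proof.
split=> clM p; first by move/closure_adherent/clM.
by move/closure_adherent/clM.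
Qed.

Lemma dense_nrm (D : set H) :
  dense D <-> forall x r, 0 < r -> exists2 y, D y & nrm (x - y) < r.
Proof.
split=> [dD x r r0 | dD U [x Ux] oU].
  have rC : 0 < r%:C :> R[i] by rewrite ltcR.
  have [||y [xy Dy]] := dD (ball x r%:C).
  - by exists x; exact: ballxx.
  - exact: ball_open.
  by exists y => //; apply/ball_nrm.
have /nbhs_ballP[_ /gt0_realC[r r0 ->] rU] := open_nbhs_nbhs (conj oU Ux).
have [y Dy xy] := dD x r r0.
by exists y; split=> //; apply: rU; apply/ball_nrm.
Qed.

Lemma nrm_distC x y : nrm (x - y) = nrm (y - x).
Proof. by rewrite -nrmN opprB. Qed.

Lemma nrm_triangle z x y : nrm (x - y) <= nrm (x - z) + nrm (z - y).
Proof. by have := nrmD (x - z) (z - y); rewrite addrA subrK. Qed.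

Lemma nrm_complete (u : nat -> H) (e : nat -> R) :
  (forall m n, (n <= m)%N -> nrm (u m - u n) <= e n) ->
  (forall r, 0 < r -> exists n, e n < r) ->
  exists l, forall n, nrm (l - u n) <= e n.
Proof.
move=> ue e0.
have : cvg (u @ \oo).
  apply/cauchy_cvgP/cauchy_exP => _ /gt0_realC[r r0 ->].
  have [n en] := e0 r r0.
  exists (u n); exists n => // m /= nm.
  apply/ball_nrm; rewrite nrm_distC; exact: le_lt_trans (ue _ _ nm) en.
move=> /cvg_ex[l ul]; exists l => n; apply/ler_addgt0Pr => r r0.
have /ul [m _ ml] : nbhs l (ball l r%:C) by apply: nbhsx_ballx; rewrite ltcR.
have /ball_nrm h := ml (maxn m n) (leq_maxl _ _).
have := ue (maxn m n) n (leq_maxr _ _).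
have := nrm_triangle (u (maxn m n)) l (u n). lra.
Qed.
End Topology.

(** * Limits along 1 / (n + 1) and orthogonal projection *)

Section Projection.
Variables (R : realType) (H : hilbertType R).
Implicit Types (x y z : H) (r : R) (M : set (H * H)) (p : H * H).

Lemma dotRBl x y z : dotR (x - y) z = dotR x z - dotR y z.
Proof. by rewrite dotRDl dotRNl. Qed.
Lemma dotRBr x y z : dotR z (x - y) = dotR z x - dotR z y.
Proof. by rewrite dotRDr dotRNr. Qed.
Lemma dotR0l x : dotR 0 x = 0. Proof. by rewrite -(subrr x) dotRBl subrr. Qed.
Lemma dotR0r x : dotR x 0 = 0. Proof. by rewrite dotRC dotR0l. Qed.
Lemma dotR_ext x y : (forall z, dotR x z = dotR y z) -> x = y.
Proof.
by move=> xy; apply/eqP; rewrite -subr_eq0; apply/eqP/dotR_eq0; rewrite dotRBl xy subrr.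
Qed.
Definition dotRE := (dotRDl, dotRDr, dotRNl, dotRNr, dotRZl, dotRZr, dotR0l, dotR0r).

Definition eps (n : nat) : R := n.+1%:R^-1.

Lemma eps_gt0 n : 0 < eps n. Proof. by rewrite invr_gt0 ltr0Sn. Qed.

Lemma div_small (c r : R) : 0 < r -> exists n : nat, c * eps n < r.
Proof.
move=> r0; exists (Num.bound (`|c| / r)).
have := archi_boundP (divr_ge0 (normr_ge0 c) (ltW r0)).
rewrite ltr_pdivrMr // => h; rewrite ltr_pdivrMr ?ltr0Sn //.
apply: le_lt_trans (ler_norm c) _; apply: lt_trans h _.
by rewrite mulrC ltr_pM2l // ltr_nat.
Qed.

Lemma le_small (a b c : R) : (forall n : nat, a <= b + c * eps n) -> a <= b.
Proof.
move=> h; apply/ler_addgt0Pr => r r0; have [n cn] := div_small c r0.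
by have := h n; lra.
Qed.

Lemma eq_small (a b c : R) : (forall n : nat, `|a - b| <= c * eps n) -> a = b.
Proof.
move=> h; apply/eqP; rewrite eq_le; apply/andP; split; apply: (@le_small _ _ c) => n;
  by have := h n; rewrite ler_norml => /andP[h1 h2]; lra.
Qed.

Definition real_subspace M := M (0, 0) /\
  forall r x y x' y', M (x, y) -> M (x', y') -> M (rscale r x + x', rscale r y + y').

(** Stated for pairs, with the sum of the two real forms as inner product, because it is applied to
    graphs in H x H. *)
Lemma projection M : real_subspace M -> (forall p, adherent M p -> M p) ->
  forall x y, exists x' y', M (x', y') /\
    forall u v, M (u, v) -> dotR (x - x') u + dotR (y - y') v = 0.
Proof.
move=> [M0 Mlin] clM x y.
pose G (q : H * H) := dotR (x - q.1) (x - q.1) + dotR (y - q.2) (y - q.2).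
have G_ge0 q : 0 <= G q by rewrite addr_ge0 ?dotR_ge0.
pose D := [set G q | q in M].
have hD : has_inf D.
  by split; [exists (G (0, 0)), (0, 0) | exists 0 => _ [q _ <-]].
pose d := inf D.
have Gd q : M q -> d <= G q by move=> Mq; apply: ge_inf; [case: hD | exists q].
have /choice[q qP] (n : nat) : exists q, M q /\ G q < d + eps n ^+ 2.
  have [|_ [q Mq <-] h] := @inf_adherent _ D (eps n ^+ 2) _ hD; last by exists q.
  by rewrite exprn_gt0 ?eps_gt0.
have invle m n : (n <= m)%N -> eps m ^+ 2 <= eps n ^+ 2 :> R.
  move=> nm; rewrite ler_sqr ?nnegrE ?(ltW (eps_gt0 _)) //.
  by rewrite /eps lef_pV2 ?posrE ?ltr0Sn // ler_nat.
(* Parallelogram law: the midpoint of [q m] and [q n] lies in M, so its value of G is at least d.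
   The squared distance is then at most 2 (eps m ^ 2 + eps n ^ 2), hence at most (2 eps n) ^ 2. *)
have qCauchy m n : (n <= m)%N ->
  nrm ((q m).1 - (q n).1) <= 2 * eps n /\ nrm ((q m).2 - (q n).2) <= 2 * eps n.
  move=> /invle nm; have [Mm Gm] := qP m; have [Mn Gn] := qP n.
  have h : M (rscale 2^-1 (q m).1 + (rscale 2^-1 (q n).1 + 0),
              rscale 2^-1 (q m).2 + (rscale 2^-1 (q n).2 + 0)).
    apply: (Mlin); first by case: (q m) Mm.
    by apply: (Mlin); first by case: (q n) Mn.
  have {h} := Gd _ h.
  rewrite /G /= in Gm Gn *; rewrite !dotRE !(dotRC _ x) !(dotRC _ y) in Gm Gn *.
  rewrite !(dotRC (q n).1 (q m).1) !(dotRC (q n).2 (q m).2).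
  move=> h.
  have n1 := dotR_ge0 ((q m).1 - (q n).1); have n2 := dotR_ge0 ((q m).2 - (q n).2).
  have e0 : 0 <= 2 * eps n :> R by rewrite mulr_ge0 ?ltW ?eps_gt0.
  have e2 : (2 * eps n) ^+ 2 = 4 * eps n ^+ 2 :> R by rewrite exprMn; ring.
  split; rewrite -ler_sqr ?nnegrE ?nrm_ge0 // e2 -dotR_nrm;
   rewrite !dotRE !(dotRC (q n).1 (q m).1) !(dotRC (q n).2 (q m).2) in n1 n2 *; lra.
have small2 r : 0 < r -> exists n : nat, 2 * eps n < r by apply: div_small.
have [x' x'P] := @nrm_complete _ _ (fun n => (q n).1) (fun n => 2 * eps n)
  (fun m n h => proj1 (qCauchy m n h)) small2.
have [y' y'P] := @nrm_complete _ _ (fun n => (q n).2) (fun n => 2 * eps n)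
  (fun m n h => proj2 (qCauchy m n h)) small2.
exists x', y'; split.
  apply: clM => r /small2[n nr]; exists (q n); first by case: (qP n).
  by split; [apply: le_lt_trans (x'P n) nr | apply: le_lt_trans (y'P n) nr].
move=> u v Muv.
(* Compares the almost minimal [q n] with its perturbation by t (u, v). Taking t = eps n and t = -
   eps n balances the two error terms on the right. *)
have key n t : 2 * t * (dotR (x - (q n).1) u + dotR (y - (q n).2) v) <=
    eps n ^+ 2 + t ^+ 2 * (dotR u u + dotR v v).
  have [Mq Gq] := qP n.
  have h : M (rscale t u + (q n).1, rscale t v + (q n).2).
    by apply: (Mlin) => //; case: (q n) Mq.
  have {h} := Gd _ h; rewrite /G /= in Gq *; rewrite !dotRE in Gq *.
  rewrite !(dotRC _ x) !(dotRC _ y) in Gq *; rewrite !(dotRC u (q n).1) !(dotRC v (q n).2); lra.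
apply: (@eq_small _ _ (1 + (dotR u u + dotR v v) + 2 * (nrm u + nrm v))) => n.
rewrite subr0.
have e0 : 0 < eps n  by exact: eps_gt0.
have hx := x'P n; have hy := y'P n.
have k1 := key n (eps n); have k2 := key n (- eps n).
set e := eps n in e0 hx hy k1 k2 *.
have cx := cauchy_schwarz (x' - (q n).1) u; have cy := cauchy_schwarz (y' - (q n).2) v.
have hxu := ler_wpM2r (nrm_ge0 u) hx; have hyv := ler_wpM2r (nrm_ge0 v) hy.
set b := dotR (x - (q n).1) u + dotR (y - (q n).2) v in k1 k2.
have b1 : 2 * b <= e * (1 + (dotR u u + dotR v v)).
  by rewrite -(ler_pM2l e0); lra.
have b2 : - (2 * b) <= e * (1 + (dotR u u + dotR v v)).
  by rewrite -(ler_pM2l e0); lra.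
have -> : dotR (x - x') u + dotR (y - y') v = b - dotR (x' - (q n).1) u - dotR (y' - (q n).2) v.
  by rewrite /b !dotRE; ring.
have p0 : 0 <= e * (1 + (dotR u u + dotR v v)).
  by apply: mulr_ge0; [exact: ltW | rewrite !addr_ge0 ?dotR_ge0].
move: cx cy; rewrite !ler_norml => /andP[cx1 cx2] /andP[cy1 cy2].
apply/andP; split; lra.
Qed.

End Projection.
Arguments eps {R} n.

(** * Square roots of bounded positive maps *)

Section Bounded.
Variables (R : realType) (H : hilbertType R).
Implicit Types (x y z : H) (r : R) (M : set (H * H)) (f S D T : H -> H).

Definition real_linear f := forall r x y, f (rscale r x + y) = rscale r (f x) + f y.
Definition bounded_by (k : R) f := forall x, nrm (f x) <= k * nrm x.
Definition bounded_map f := real_linear f /\ exists2 k, 0 <= k & bounded_by k f.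
Definition symmetric_map f := forall x y, dotR (f x) y = dotR x (f y).
Definition positive_map f := forall x, 0 <= dotR (f x) x.
Definition commutes f S := forall x, f (S x) = S (f x).

Lemma rscale1 x : rscale 1 x = x. Proof. by rewrite /rscale scale1r. Qed.
Lemma real_linearD f x y : real_linear f -> f (x + y) = f x + f y.
Proof. by move=> /(_ 1 x y); rewrite !rscale1. Qed.
Lemma real_linear0 f : real_linear f -> f 0 = 0.
Proof. by move=> /(real_linearD 0 0) h; apply: (@addrI _ (f 0)); rewrite -h !addr0. Qed.
Lemma real_linearZ f r x : real_linear f -> f (rscale r x) = rscale r (f x).
Proof. by move=> fl; have := fl r x 0; rewrite !addr0 real_linear0 ?addr0. Qed.
Lemma real_linearN f x : real_linear f -> f (- x) = - f x.
Proof.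
by move=> fl; apply: (@addrI _ (f x)); rewrite -real_linearD // !subrr real_linear0.
Qed.
Lemma real_linearB f x y : real_linear f -> f (x - y) = f x - f y.
Proof. by move=> fl; rewrite real_linearD // real_linearN. Qed.

(** Testing against every z moves f to the other argument, where the form is linear. *)
Lemma symmetric_map_linear f : symmetric_map f -> real_linear f.
Proof. by move=> fs r x y; apply: dotR_ext => z; rewrite !(fs, dotRE). Qed.

Lemma imul_linear : real_linear (@imul R H).
Proof. by move=> r x y; apply: dotR_ext => z; rewrite !(dotRiC, dotRE); lra. Qed.

Lemma imul_bounded : bounded_map (@imul R H).
Proof.
by split; [exact: imul_linear | exists 1 => // x; rewrite nrm_imul mul1r].
Qed.

(* The iteration Y_(n+1) = (D + Y_n^2) / 2 converges to Y with (1 - Y)^2 = 1 - D.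
   It is dominated by the scalar one with D = 1, whose limit is 1, so that
   |Y_m - Y_n| <= y_m - y_n <= 2 / (n + 2). *)
Fixpoint sqrt_seq (n : nat) : R := if n is m.+1 then (1 + sqrt_seq m ^+ 2) / 2 else 0.

Lemma sqrt_seq_bounds n : 0 <= sqrt_seq n <= 1 /\ 1 - sqrt_seq n <= 2 * eps n.+1.
Proof.
elim: n => [|n [/andP[y0 y1] IH]] /=.
  by split; [rewrite lexx ler01 | rewrite subr0 /eps mulfV ?lexx ?pnatr_eq0].
have e1 := @eps_gt0 R n.+1; have e2 := @eps_gt0 R n.+2.
have ee : eps n.+2 * (1 + eps n.+1) = eps n.+1 :> R.
  rewrite /eps -(natr1 n.+2); have : n.+2%:R != 0 :> R by rewrite pnatr_eq0.
  have : n.+2%:R + 1 != 0 :> R by rewrite natr1 pnatr_eq0.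
  by move: (n.+2%:R : R) => a h1 h2; field; rewrite h1 h2.
have e3 : eps n.+1 <= 1 / 2 :> R.
  by rewrite /eps div1r lef_pV2 ?posrE ?ltr0Sn // ler_nat.
move: (sqrt_seq n) (eps n.+1) (eps n.+2) y0 y1 IH e1 e2 e3 ee => y e e' y0 y1 IH e1 e2 e3 ee.
split; first by apply/andP; split; nra.
(* In t = 1 - y the iteration is t - t^2 / 2, which increases on [0, 1], and t <= 2 e <= 1. *)
have k : 1 - (1 + y ^+ 2) / 2 <= 2 * (e * (1 - e)) by nra.
apply: le_trans k _; rewrite -{1}ee; nra.
Qed.

Section Iteration.
Variables (D : H -> H) (symD : symmetric_map D) (bdD : bounded_by 1 D).

Fixpoint sqrt_iter (n : nat) (x : H) : H :=
  if n is m.+1 then rscale 2^-1 (D x + sqrt_iter m (sqrt_iter m x)) else 0.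

Lemma sqrt_iter_sym n : symmetric_map (sqrt_iter n).
Proof.
elim: n => [|n IH] x y /=; first by rewrite !dotRE.
by rewrite !dotRE symD IH IH.
Qed.
Let yl n : real_linear (sqrt_iter n) := symmetric_map_linear (@sqrt_iter_sym n).

Lemma sqrt_iter_comm S n : real_linear S -> commutes S D -> commutes S (sqrt_iter n).
Proof.
move=> Sl SD; elim: n => [|n IH] x /=; first by rewrite real_linear0.
by rewrite real_linearZ // real_linearD // SD !IH.
Qed.

Lemma sqrt_iter_commutes m n : commutes (sqrt_iter m) (sqrt_iter n).
Proof.
apply: sqrt_iter_comm => // x; apply/esym/sqrt_iter_comm => //; exact: symmetric_map_linear.
Qed.

Lemma sqrt_iter_bound n : bounded_by (sqrt_seq n) (sqrt_iter n).
Proof.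
elim: n => [|n IH] x /=; first by rewrite nrm0 mul0r.
rewrite nrm_rscale ger0_norm ?invr_ge0 //.
have [/andP[y0 _] _] := sqrt_seq_bounds n.
have := nrmD (D x) (sqrt_iter n (sqrt_iter n x)); have := bdD x.
have := IH (sqrt_iter n x); have := ler_wpM2l y0 (IH x). lra.
Qed.

(** The iterates commute, so the difference of two consecutive squares factors as (Y_(n+1) + Y_n)
    (Y_(n+1) - Y_n). The scalar sequence has the same factorization, and the bound follows by
    induction. *)
Lemma sqrt_iter_step n x :
  nrm (sqrt_iter n.+1 x - sqrt_iter n x) <= (sqrt_seq n.+1 - sqrt_seq n) * nrm x.
Proof.
elim: n x => [|n IH] x.
  rewrite /= addr0 !subr0 nrm_rscale ger0_norm ?invr_ge0 //; have := bdD x; lra.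
pose w := sqrt_iter n.+1 x - sqrt_iter n x.
have -> : sqrt_iter n.+2 x - sqrt_iter n.+1 x = rscale 2^-1 (sqrt_iter n.+1 w + sqrt_iter n w).
  rewrite /w (real_linearB _ _ (yl n.+1)) (real_linearB _ _ (yl n)).
  rewrite (sqrt_iter_commutes n.+1 n x).
  rewrite [in LHS]/= -/(sqrt_iter n.+1).
  by apply: dotR_ext => z; rewrite !dotRE; lra.
rewrite nrm_rscale ger0_norm ?invr_ge0 //.
have [/andP[y0 _] _] := sqrt_seq_bounds n; have [/andP[y0' _] _] := sqrt_seq_bounds n.+1.
have h := nrmD (sqrt_iter n.+1 w) (sqrt_iter n w).
have h1 := sqrt_iter_bound n.+1 w; have h2 := sqrt_iter_bound n w.
have h3 := ler_wpM2l (addr_ge0 y0' y0) (IH x).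
have -> : sqrt_seq n.+2 - sqrt_seq n.+1 =
    2^-1 * ((sqrt_seq n.+1 + sqrt_seq n) * (sqrt_seq n.+1 - sqrt_seq n)).
  by rewrite [sqrt_seq n.+2]/= -/(sqrt_seq n.+1) [X in _ - X]/=; field.
rewrite -/w in h3; lra.
Qed.

Lemma sqrt_iter_diff m n x : (n <= m)%N ->
  nrm (sqrt_iter m x - sqrt_iter n x) <= (sqrt_seq m - sqrt_seq n) * nrm x.
Proof.
elim: m => [|m IH]; first by rewrite leqn0 => /eqP ->; rewrite !subrr nrm0 mul0r.
rewrite leq_eqVlt => /orP[/eqP -> | /IH h]; first by rewrite !subrr nrm0 mul0r.
have := nrm_triangle (sqrt_iter m x) (sqrt_iter m.+1 x) (sqrt_iter n x).
have := sqrt_iter_step m x. lra.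
Qed.

End Iteration.
End Bounded.

(** * Positive maps and their square roots *)

Section Sqrt.
Variables (R : realType) (H : hilbertType R).
Implicit Types (x y z : H) (r : R) (M : set (H * H)) (f S D T : H -> H).

Lemma eq_small_nrm x y (c : R) : (forall n, nrm (x - y) <= c * eps n) -> x = y.
Proof.
move=> h; apply/eqP; rewrite -subr_eq0; apply/eqP/nrm_eq0/eqP.
rewrite eq_le nrm_ge0 andbT; apply: (@le_small _ _ _ c) => n.
by rewrite add0r.
Qed.

Lemma epsS n : eps n.+1 <= eps n :> R.
Proof. by rewrite /eps lef_pV2 ?posrE ?ltr0Sn // ler_nat. Qed.

Lemma sqrt_iter_limit D : symmetric_map D -> bounded_by 1 D -> exists Y : H -> H,
  [/\ symmetric_map Y, bounded_by 1 Y, (forall x, rscale 2 (Y x) = D x + Y (Y x)) &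
      forall S, bounded_map S -> commutes S D -> commutes S Y].
Proof.
move=> Ds Db.
have diff m n x : (n <= m)%N -> nrm (sqrt_iter D m x - sqrt_iter D n x) <= 2 * nrm x * eps n.
  move=> nm; apply: le_trans (sqrt_iter_diff Ds Db x nm) _.
  have [/andP[_ y1] _] := sqrt_seq_bounds R m; have [_ y2] := sqrt_seq_bounds R n.
  have := epsS n; have x0 := nrm_ge0 x => e.
  have k : sqrt_seq R m - sqrt_seq R n <= 2 * eps n by lra.
  by have := ler_wpM2r x0 k; lra.
have small x r : 0 < r -> exists n, 2 * nrm x * eps n < r by apply: div_small.
have /choice[Y YP] x : exists l, forall n, nrm (l - sqrt_iter D n x) <= 2 * nrm x * eps n.
  exact: nrm_complete (fun m n nm => diff m n x nm) (small x).
have yl n := symmetric_map_linear (sqrt_iter_sym Ds n).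
have yb n x : nrm (sqrt_iter D n x) <= nrm x.
  apply: le_trans (sqrt_iter_bound Db n x) _; have [/andP[_ y1] _] := sqrt_seq_bounds R n.
  by rewrite ler_piMl ?nrm_ge0.
have Ysym : symmetric_map Y.
  move=> x y; apply: (@eq_small _ _ _ (2 * nrm x * nrm y + 2 * nrm x * nrm y)) => n.
  have := ler_wpM2r (nrm_ge0 y) (YP x n); have := ler_wpM2l (nrm_ge0 x) (YP y n).
  have := cauchy_schwarz (Y x - sqrt_iter D n x) y; have := cauchy_schwarz x (Y y - sqrt_iter D n y).
  rewrite !dotRE (sqrt_iter_sym Ds n x y).
  rewrite !ler_norml => /andP[a1 a2] /andP[b1 b2] h1 h2.
  by apply/andP; split; lra.
have Yl := symmetric_map_linear Ysym.
have Yb : bounded_by 1 Y.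
  move=> x; rewrite mul1r; apply: (@le_small _ _ _ (2 * nrm x)) => n.
  by have := nrm_triangle (sqrt_iter D n x) (Y x) 0; rewrite !subr0;
    have := YP x n; have := yb n x; lra.
exists Y; split => //.
  (* A generous constant: the three terms below contribute at most 6 |x| + 2 |Y x| times [eps n]. *)
  move=> x; apply: (@eq_small_nrm _ _ (10 * (nrm x + nrm (Y x)))) => n.
  have -> : rscale 2 (Y x) - (D x + Y (Y x)) =
    rscale 2 (Y x - sqrt_iter D n.+1 x) +
    (sqrt_iter D n (sqrt_iter D n x - Y x) - (Y (Y x) - sqrt_iter D n (Y x))).
    rewrite (real_linearB _ _ (yl n)) [sqrt_iter D n.+1 x]/=.
    by apply: dotR_ext => z; rewrite !dotRE; lra.
  have := nrmD (rscale 2 (Y x - sqrt_iter D n.+1 x))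
    (sqrt_iter D n (sqrt_iter D n x - Y x) - (Y (Y x) - sqrt_iter D n (Y x))).
  have := nrmD (sqrt_iter D n (sqrt_iter D n x - Y x)) (- (Y (Y x) - sqrt_iter D n (Y x))).
  rewrite nrmN nrm_rscale ger0_norm //.
  have := yb n (sqrt_iter D n x - Y x); rewrite (nrm_distC (sqrt_iter D n x)).
  have := YP x n; have := YP x n.+1; have := YP (Y x) n.
  have := ler_wpM2l (mulr_ge0 (ler0n R 2) (nrm_ge0 x)) (epsS n).
  have := mulr_ge0 (nrm_ge0 x) (ltW (eps_gt0 R n)).
  have := mulr_ge0 (nrm_ge0 (Y x)) (ltW (eps_gt0 R n)).
  lra.
move=> S [Sl [k k0 Sk]] SD x.
apply: (@eq_small_nrm _ _ (2 * k * nrm x + 2 * nrm (S x))) => n.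
have -> : S (Y x) - Y (S x) = S (Y x - sqrt_iter D n x) + - (Y (S x) - sqrt_iter D n (S x)).
  rewrite real_linearB // (sqrt_iter_comm n Sl SD x).
  by apply: dotR_ext => z; rewrite !dotRE; lra.
have := nrmD (S (Y x - sqrt_iter D n x)) (- (Y (S x) - sqrt_iter D n (S x))).
rewrite nrmN; have := Sk (Y x - sqrt_iter D n x); have := ler_wpM2l k0 (YP x n).
have := YP (S x) n; lra.
Qed.

Lemma pos_cauchy_schwarz f x y : symmetric_map f -> positive_map f ->
  dotR (f x) y ^+ 2 <= dotR (f x) x * dotR (f y) y.
Proof.
move=> fs fp; have fl := symmetric_map_linear fs.
have h t : 0 <= dotR (f x) x * t ^+ 2 + 2 * dotR (f x) y * t + dotR (f y) y.
  have := fp (rscale t x + y); rewrite fl !dotRE (fs y x) (dotRC y); lra.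
have [a0|a0] := eqVneq (dotR (f x) x) 0.
  rewrite a0 in h *; rewrite mul0r.
  have [-> | b0] := eqVneq (dotR (f x) y) 0; first by rewrite expr0n.
  (* With zero leading coefficient the polynomial is affine in t, and this t gives it the value -1.
     In the other case t is the vertex of the parabola. *)
  have := h (- (dotR (f y) y + 1) / (2 * dotR (f x) y)).
  have -> : 0 * (- (dotR (f y) y + 1) / (2 * dotR (f x) y)) ^+ 2 +
    2 * dotR (f x) y * (- (dotR (f y) y + 1) / (2 * dotR (f x) y)) + dotR (f y) y = - 1 by field.
  by rewrite ler0N1.
have ap : 0 < dotR (f x) x by rewrite lt_def a0 fp.
have := h (- dotR (f x) y / dotR (f x) x).
have -> : dotR (f x) x * (- dotR (f x) y / dotR (f x) x) ^+ 2 +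
    2 * dotR (f x) y * (- dotR (f x) y / dotR (f x) x) + dotR (f y) y =
    (dotR (f x) x * dotR (f y) y - dotR (f x) y ^+ 2) / dotR (f x) x by field.
by rewrite ler_pdivlMr // mul0r subr_ge0.
Qed.

Lemma pos_ker f x : symmetric_map f -> positive_map f -> dotR (f x) x = 0 -> f x = 0.
Proof.
move=> fs fp fx0; apply: dotR_eq0; apply/eqP.
rewrite -sqrf_eq0 eq_le sqr_ge0 andbT; have := pos_cauchy_schwarz x (f x) fs fp.
by rewrite fx0 mul0r.
Qed.

(* Cauchy-Schwarz for the form [dotR (f x) y], applied to [y := f x]. *)
Lemma pos_le1_bounded f : symmetric_map f -> positive_map f ->
  (forall x, dotR (f x) x <= dotR x x) ->
  bounded_by 1 f.
Proof.
move=> fs fp f1 x; rewrite mul1r; apply: nrm_le.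
have := pos_cauchy_schwarz x (f x) fs fp; have := f1 (f x); have := f1 x; have := fp x.
have := dotR_ge0 (f x).
move: (dotR (f x) (f x)) (dotR (f x) x) (dotR x x) (dotR (f (f x)) (f x)) => a b c d a0 b0 bc da h.
rewrite leNgt; apply/negP => ca.
have : a ^+ 2 <= b * a by apply: le_trans h _; apply: ler_wpM2l.
by rewrite expr2 ler_pM2r; [lra | lra].
Qed.

(** Apply the iteration to D = 1 - T: the root is 1 - Y, and it is positive because Y is bounded by
    1. *)
Lemma sqrt_contraction T : symmetric_map T -> positive_map T ->
  (forall x, dotR (T x) x <= dotR x x) ->
  exists Q : H -> H, [/\ symmetric_map Q, positive_map Q, bounded_by 2 Q, (forall x, Q (Q x) = T x) &
    forall S, bounded_map S -> commutes S T -> commutes S Q].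
Proof.
move=> Ts Tp T1; have Tl := symmetric_map_linear Ts.
pose D x := x - T x.
have Ds : symmetric_map D by move=> x y; rewrite /D !dotRE Ts.
have Db : bounded_by 1 D.
  apply: pos_le1_bounded => // x; rewrite /D !dotRE ?subr_ge0 //.
  by have := Tp x; lra.
have [Y [Ys Yb YE Yc]] := sqrt_iter_limit Ds Db; have Yl := symmetric_map_linear Ys.
exists (fun x => x - Y x); split.
- by move=> x y; rewrite !dotRE Ys.
- move=> x; have := cauchy_schwarz (Y x) x; rewrite !dotRE dotR_nrm.
  have := ler_wpM2r (nrm_ge0 x) (Yb x); rewrite ler_norml => h1 /andP[_ h2]; lra.
- by move=> x; have := nrmD x (- Y x); rewrite nrmN; have := Yb x; lra.
- move=> x; rewrite real_linearB //.
  have := YE x; rewrite /D => e.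
  apply: dotR_ext => z; have := congr1 (fun u => dotR u z) e; rewrite !dotRE; lra.
move=> S Sb ST x; rewrite (real_linearB _ _ Sb.1) (Yc S) // => u.
by rewrite /D (real_linearB _ _ Sb.1) ST.
Qed.

Lemma sqrt_pos T : symmetric_map T -> positive_map T ->
  (exists2 k, 0 <= k & bounded_by k T) ->
  exists Q : H -> H, [/\ symmetric_map Q, positive_map Q, exists2 k, 0 <= k & bounded_by k Q,
    (forall x, Q (Q x) = T x) & forall S, bounded_map S -> commutes S T -> commutes S Q].
Proof.
move=> Ts Tp [k k0 Tk]; have Tl := symmetric_map_linear Ts.
(* The added 1 keeps the scaling factor positive when k = 0. *)
pose c := k + 1; have c0 : 0 < c by rewrite /c; lra.
have ci0 : 0 <= c^-1 by rewrite invr_ge0 ltW.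
have [||x|Q [Qs Qp Qb QQ Qc]] := @sqrt_contraction (fun x => rscale c^-1 (T x)).
- by move=> x y; rewrite !dotRE Ts.
- by move=> x; rewrite !dotRE mulr_ge0.
- rewrite !dotRE mulrC ler_pdivrMr //.
  have := cauchy_schwarz (T x) x; have := ler_wpM2r (nrm_ge0 x) (Tk x); have := dotR_ge0 x.
  rewrite /c ler_norml dotR_nrm => h h1 /andP[_ h2]; lra.
have Ql := symmetric_map_linear Qs.
have rscaleA a b x : rscale a (rscale b x) = rscale (a * b) x :> H.
  by apply: dotR_ext => z; rewrite !dotRE; lra.
have s0 := sqrtr_ge0 c.
exists (fun x => rscale (Num.sqrt c) (Q x)); split.
- by move=> x y; rewrite !dotRE Qs.
- by move=> x; rewrite !dotRE mulr_ge0.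
- exists (Num.sqrt c * 2); first by rewrite mulr_ge0.
  by move=> x; rewrite nrm_rscale ger0_norm // -mulrA ler_wpM2l.
- move=> x; rewrite real_linearZ // QQ !rscaleA -expr2 sqr_sqrtr ?ltW // mulfV ?rscale1 //.
  exact: lt0r_neq0.
move=> S Sb ST x; rewrite (real_linearZ _ _ Sb.1) (Qc S) // => u.
by rewrite (real_linearZ _ _ Sb.1) ST.
Qed.

(* By uniqueness [Z] is the square root of [Z \o Z] given by [sqrt_pos]. *)
Lemma commutes_sqr Z S : symmetric_map Z -> positive_map Z -> bounded_map Z -> bounded_map S ->
  commutes S (fun x => Z (Z x)) -> commutes S Z.
Proof.
move=> Zs Zp [Zl [k k0 Zk]] Sb SZZ.
have [||| Q [Qs Qp _ QQ Qc]] := @sqrt_pos (fun x => Z (Z x)).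
- by move=> x y; rewrite !Zs.
- by move=> x; rewrite Zs dotR_ge0.
- exists (k * k) => [|x]; first exact: mulr_ge0.
  by rewrite -mulrA; apply: le_trans (Zk _) _; apply: ler_wpM2l.
have Ql := symmetric_map_linear Qs.
have ZQ : commutes Z Q by apply: Qc => //; split=> //; exists k.
suff e : forall x, Z x = Q x by move=> x; rewrite !e; apply: Qc.
move=> x; apply/eqP; rewrite -subr_eq0; apply/eqP.
pose y := Z x - Q x.
have ZQy : Z y + Q y = 0.
  by rewrite /y (real_linearB _ _ Zl) (real_linearB _ _ Ql) QQ ZQ addrA subrK subrr.
have sum : dotR (Z y) y + dotR (Q y) y = 0 by rewrite -dotRDl ZQy dotR0l.
have zy : Z y = 0 by apply: pos_ker => //; have := Zp y; have := Qp y; lra.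
have qy : Q y = 0 by apply: pos_ker => //; have := Zp y; have := Qp y; lra.
apply: dotR_eq0; rewrite -/y {1}/y dotRBl Zs Qs zy qy dotR0r; lra.
Qed.

(* With [Q] the square root of [f], [<f h x, x> = <h Q x, Q x>]. *)
Lemma pos_comp f h : symmetric_map f -> positive_map f ->
  (exists2 k, 0 <= k & bounded_by k f) ->
  symmetric_map h -> positive_map h -> bounded_map h -> commutes h f -> positive_map (fun x => f (h x)).
Proof.
move=> fs fp fb hs hp hb hf x.
have [Q [Qs _ _ QQ Qc]] := sqrt_pos fs fp fb.
by rewrite -QQ Qs -(Qc h) //.
Qed.

End Sqrt.

(** * Adjoints and resolvents *)

Section Graphs.
Variables (R : realType) (H : hilbertType R).
Implicit Types (x y z u v w : H) (r : R) (M T N A : set (H * H)) (f S B : H -> H).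

(** Single-valuedness is left out so that this covers [adjoint T] for every T, densely defined or
    not. *)
Definition linear_relation T := T (0, 0) /\
  forall (a : R[i]) x y x' y',
    T (x, y) -> T (x', y') -> T (a *: x + x', a *: y + y').

Lemma operator_linear T : is_operator T -> linear_relation T.
Proof. by case. Qed.

Lemma adjoint_linear T : linear_relation (adjoint T).
Proof.
split=> [x y _ /=| a x y x' y' h h' u v Tuv /=]; first by rewrite !linear0r.
by rewrite !linearDr !linearZr_LR /= (h u v) // (h' u v).
Qed.

Section LinearRelation.
Variables (T : set (H * H)) (Tl : linear_relation T).

Lemma relationD x y x' y' : T (x, y) -> T (x', y') -> T (x + x', y + y').
Proof. by case: Tl => _ /(_ 1 x y x' y'); rewrite !scale1r. Qed.
Lemma relationZ (a : R[i]) x y : T (x, y) -> T (a *: x, a *: y).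
Proof. by case: Tl => T0 /(_ a x y 0 0 _) h Txy; have := h Txy T0; rewrite !addr0. Qed.
Lemma relationN x y : T (x, y) -> T (- x, - y).
Proof. by move/(relationZ (-1)); rewrite !scaleN1r. Qed.
Lemma relationB x y x' y' : T (x, y) -> T (x', y') -> T (x - x', y - y').
Proof. by move=> h /relationN; apply: relationD. Qed.
Lemma relation_rscale r x y : T (x, y) -> T (rscale r x, rscale r y). Proof. exact: relationZ. Qed.
Lemma relation_imul x y : T (x, y) -> T (imul x, imul y). Proof. exact: relationZ. Qed.

Lemma linear_real_subspace : real_subspace T.
Proof. by split=> [|r x y x' y' h h']; [case: Tl | apply: relationD h'; apply: relation_rscale]. Qed.

(** Linearity of T allows the real identity to be applied to (i u, i v), which yields the imaginary
    part. *)
Lemma adjoint_dotRP x y :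
  adjoint T (x, y) <-> forall u v, T (u, v) -> dotR v x = dotR u y.
Proof.
split=> [h u v /h /= e | h u v Tuv /=]; first by rewrite /dotR e.
have h' := h _ _ (relation_imul Tuv).
rewrite !inner_dotR (h u v) //; congr (_ +i* _).
by move: h'; rewrite !dotRiC => /oppr_inj.
Qed.
End LinearRelation.

Lemma adjoint_dotR T u v x y : adjoint T (x, y) -> T (u, v) -> dotR v x = dotR u y.
Proof. by move=> h /h /=; rewrite /dotR => ->. Qed.

(** By [inner_dotR] this quantity is the imaginary part of <Tx, x>; testing symmetry on the pair (i
    x, i y) shows that it equals its own opposite. *)
Lemma symmetric_real T x y : symmetric_operator T -> T (x, y) -> dotR y (imul x) = 0.
Proof.
move=> [oT _ sT] Txy.
have := adjoint_dotR (sT _ Txy) (relation_imul (operator_linear oT) Txy).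
by rewrite dotRiC (dotRC (imul _)); lra.
Qed.

Lemma dense_orth0 (D : set H) x : dense D -> (forall y, D y -> dotR y x = 0) -> x = 0.
Proof.
move=> dD k; apply: dotR_eq0; apply: (@eq_small _ _ _ (nrm x)) => n; rewrite subr0.
have /dense_nrm/(_ x _ (eps_gt0 R n))[u Du yu] := dD.
rewrite -[X in dotR X _](subrK u) dotRDl (k u Du) addr0 (le_trans (cauchy_schwarz _ _)) //.
by rewrite mulrC; apply: ler_wpM2l; [exact: nrm_ge0 | exact: ltW].
Qed.

Lemma adjoint_fun T x y z : densely_defined T ->
  adjoint T (x, y) -> adjoint T (x, z) -> y = z.
Proof.
move=> dT hy hz; apply/eqP; rewrite -subr_eq0; apply/eqP/(dense_orth0 dT).
by move=> u [v Tuv]; rewrite dotRBr -(adjoint_dotR hy Tuv) -(adjoint_dotR hz Tuv) subrr.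
Qed.

Lemma adjoint_adherent T p : adherent (adjoint T) p -> adjoint T p.
Proof.
(* The limit is taken for real parts only; applying the resulting identity to (i u, i v) gives the
   imaginary part. *)
case: p => x y h u v Tuv /=.
suff limE u' v' : (forall p, adjoint T p -> dotR v' p.1 = dotR u' p.2) ->
  dotR v' x = dotR u' y.
  rewrite !inner_dotR (limE u v) => [|p /adjoint_dotR]; last by case: p => ? ?; exact.
  congr (_ +i* _); apply: oppr_inj; rewrite -!dotRiC; apply: limE => -[a b] hab /=.
  rewrite !dotRiC; congr (- _); rewrite -[imul a]/('i%C *: a) -[imul b]/('i%C *: b).
  by apply: adjoint_dotR Tuv; apply: (relationZ (adjoint_linear T)).
move=> k; apply: (@eq_small _ _ _ (nrm v' + nrm u')) => n.
have [[a b] /= hab [xa yb]] := h _ (eps_gt0 R n).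
have -> : dotR v' x - dotR u' y = dotR v' (x - a) - dotR u' (y - b) + (dotR v' a - dotR u' b).
  by rewrite !dotRE; ring.
rewrite (k _ hab) subrr addr0.
have := cauchy_schwarz v' (x - a); have := cauchy_schwarz u' (y - b).
have := ler_wpM2l (nrm_ge0 v') (ltW xa); have := ler_wpM2l (nrm_ge0 u') (ltW yb).
rewrite !ler_norml => h1 h2 /andP[a1 a2] /andP[b1 b2]; apply/andP; split; lra.
Qed.

Lemma self_adjoint_closed T : self_adjoint T -> closed_operator T.
Proof.
move=> [oT _ eT]; split=> //; apply/closed_adherent => p.
by rewrite eT; apply: adjoint_adherent.
Qed.

Lemma self_adjoint_normal T : self_adjoint T -> normal_operator T.
Proof.
by move=> sT; have [_ dT eT] := sT; split=> //; [exact: self_adjoint_closed | rewrite -eT].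
Qed.

Lemma projection_closure (D : set H) : D 0 ->
  (forall r x y, D x -> D y -> D (rscale r x + y)) ->
  forall x, exists x', (forall r, 0 < r -> exists2 y, D y & nrm (x' - y) < r) /\
    forall y, D y -> dotR (x - x') y = 0.
Proof.
move=> D0 Dl x.
pose cD y := forall r, 0 < r -> exists2 y', D y' & nrm (y - y') < r.
(* The projection theorem concerns pairs, so the closure of D is embedded as its product with
   {0}. *)
pose M := [set p : H * H | cD p.1 /\ p.2 = 0].
have cDD y : D y -> cD y by move=> Dy r r0; exists y => //; rewrite subrr nrm0.
have M0 : real_subspace M.
  split; first by split=> //=; apply: cDD.
  move=> r u v u' v' [/= cu ->] [/= cu' ->]; split=> /=; last first.
    by apply: dotR_ext => z; rewrite !dotRE mulr0 addr0.
  move=> e e0; have k0 : 0 < e / 2 / (`|r| + 1).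
    by rewrite !divr_gt0 // ltr_wpDl.
  have [a Da ua] := cu _ k0; have [|b Db ub] := cu' (e / 2); first by rewrite divr_gt0.
  exists (rscale r a + b); first exact: Dl.
  have -> : rscale r u + u' - (rscale r a + b) = rscale r (u - a) + (u' - b).
    by apply: dotR_ext => z; rewrite !dotRE; ring.
  apply: le_lt_trans (nrmD _ _) _; rewrite nrm_rscale.
  have : `|r| * nrm (u - a) <= (`|r| + 1) * nrm (u - a).
    by apply: ler_wpM2r; [exact: nrm_ge0 | lra].
  by move: ua; rewrite ltr_pdivlMr ?ltr_wpDl // => h1 h2; lra.
have clM p : adherent M p -> M p.
  case: p => u v h; split=> /=.
    move=> r r0; have r2 : 0 < r / 2 by rewrite divr_gt0.
    have [[u' v'] [/= cu' _] [uu' _]] := h _ r2.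
    have [w Dw uw] := cu' _ r2; exists w => //.
    by have := nrm_triangle u' u w; lra.
  apply: nrm_eq0; apply/eqP; rewrite eq_le nrm_ge0 andbT.
  apply/ler_addgt0Pr => r /h[[u' v'] [/= _ ->] [_]]; rewrite subr0 add0r; exact: ltW.
have [x' [y' [[/= cx' _] ho]]] := projection M0 clM x 0.
exists x'; split=> // y Dy.
by have := ho y 0; rewrite dotR0r addr0; apply; split=> //=; apply: cDD.
Qed.

Lemma dense_orth (D : set H) : D 0 ->
  (forall r x y, D x -> D y -> D (rscale r x + y)) ->
  (forall x, (forall y, D y -> dotR x y = 0) -> x = 0) -> dense D.
Proof.
move=> D0 Dl Do; apply/dense_nrm => x.
have [x' [cx' /Do/eqP]] := projection_closure D0 Dl x.
by rewrite subr_eq0 => /eqP ->.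
Qed.

(** Von Neumann's argument: project (w, 0) onto the graph of T. The residual (w - x, - y) is
    orthogonal to the graph, which says that T^* y = w - x for y = T x. *)
Lemma resolvent_graph T : closed_operator T ->
  forall w, exists p, T p /\ adjoint T (p.2, w - p.1).
Proof.
move=> [oT /closed_adherent clT] w; have Tl := operator_linear oT.
have [x [y [Txy ho]]] := projection (linear_real_subspace Tl) clT w 0.
exists (x, y); split=> //=; apply/(adjoint_dotRP Tl) => u v Tuv.
by have := ho _ _ Tuv; rewrite !dotRE !(dotRC _ u) !(dotRC _ v); lra.
Qed.

(** Pairing the differences through the adjoint gives |y - y'|^2 = - |x - x'|^2. *)
Lemma resolvent_uniq T x y z x' y' z' : linear_relation T ->
  T (x, y) -> adjoint T (y, z) -> T (x', y') -> adjoint T (y', z') ->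
  x + z = x' + z' -> x = x' /\ y = y'.
Proof.
move=> Tl h1 h2 h1' h2' e.
have a1 := relationB Tl h1 h1'; have a2 := relationB (adjoint_linear T) h2 h2'.
have := adjoint_dotR a2 a1.
have -> : z - z' = - (x - x').
  by apply/eqP; rewrite -addr_eq0 addrACA -opprD [z + x]addrC e [z' + _]addrC subrr.
rewrite dotRNr => k; have := dotR_ge0 (x - x'); have := dotR_ge0 (y - y') => g1 g2.
by split; apply/eqP; rewrite -subr_eq0; apply/eqP; apply: dotR_eq0; lra.
Qed.

Section Resolvent.
Variable T : set (H * H).

(* That is, R = (1 + T^*T)^-1 and Z = T R. *)
Definition resolvent (Ro Z : H -> H) := forall w,
  T (Ro w, Z w) /\ adjoint T (Z w, w - Ro w).

Lemma resolvent_ex : closed_operator T -> exists Ro Z, resolvent Ro Z.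
Proof.
move=> /resolvent_graph/choice[q qP].
by exists (fun w => (q w).1), (fun w => (q w).2) => w; rewrite -surjective_pairing.
Qed.

Variables Ro Z : H -> H.
Hypotheses (oT : is_operator T) (rT : resolvent Ro Z).
Let Tl := operator_linear oT.
Let Al := adjoint_linear T.

Lemma resolvent_eq x y z : T (x, y) -> adjoint T (y, z) -> Ro (x + z) = x /\ Z (x + z) = y.
Proof.
move=> h1 h2; have [k1 k2] := rT (x + z).
by apply: resolvent_uniq k1 k2 h1 h2 _ => //; rewrite subrKC.
Qed.

Lemma resolvent_linear r x y : Ro (rscale r x + y) = rscale r (Ro x) + Ro y /\
   Z (rscale r x + y) = rscale r (Z x) + Z y.
Proof.
have [a1 a2] := rT x; have [b1 b2] := rT y.
have := resolvent_eq (relationD Tl (relation_rscale Tl r a1) b1) (relationD Al (relation_rscale Al r a2) b2).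
suff -> : rscale r (Ro x) + Ro y + (rscale r (x - Ro x) + (y - Ro y)) = rscale r x + y by [].
by apply: dotR_ext => z; rewrite !dotRE; ring.
Qed.

Lemma resolvent_imul x : Ro (imul x) = imul (Ro x) /\ Z (imul x) = imul (Z x).
Proof.
have [a1 a2] := rT x; have := resolvent_eq (relation_imul Tl a1) (relation_imul Al a2).
by rewrite -(real_linearD _ _ (@imul_linear _ _)) subrKC.
Qed.

Lemma Ro_norms w : dotR w (Ro w) = dotR (Ro w) (Ro w) + dotR (Z w) (Z w).
Proof. by have [a1 a2] := rT w; rewrite (adjoint_dotR a2 a1) dotRBr (dotRC w); lra. Qed.

Lemma Ro_sym : symmetric_map Ro.
Proof.
suff k w v : dotR (Ro w) v = dotR (Ro w) (Ro v) + dotR (Z w) (Z v).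
  by move=> x y; rewrite k [RHS]dotRC (k y) (dotRC (Ro y)) (dotRC (Z y)).
have [a1 _] := rT w; have [_ b2] := rT v.
by rewrite (adjoint_dotR b2 a1) dotRBr; lra.
Qed.

Lemma Ro_pos : positive_map Ro.
Proof. by move=> w; rewrite dotRC Ro_norms addr_ge0 ?dotR_ge0. Qed.

Lemma Ro_bounded : bounded_by 1 Ro.
Proof.
move=> w; rewrite mul1r; have := Ro_norms w; have := cauchy_schwarz w (Ro w).
rewrite ler_norml => /andP[_ h] e; rewrite e dotR_nrm in h.
rewrite leNgt; apply/negP => lt; have h2 := dotR_ge0 (Z w).
by have w0 := nrm_ge0 w; nra.
Qed.

Lemma Z_bounded : bounded_by 1 Z.
Proof.
move=> w; rewrite mul1r; apply: nrm_le.
have := Ro_norms w; have := cauchy_schwarz w (Ro w); rewrite ler_norml => /andP[_ h] e.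
have := Ro_bounded w; have := dotR_ge0 (Ro w); rewrite mul1r (dotR_nrm w) => h1 h2.
by have := ler_wpM2l (nrm_ge0 w) h2; lra.
Qed.

Lemma Ro_bounded_map : bounded_map Ro.
Proof.
by split; [move=> r x y; case: (resolvent_linear r x y) | exists 1 => //; exact: Ro_bounded].
Qed.

Lemma Z_bounded_map : bounded_map Z.
Proof.
by split; [move=> r x y; case: (resolvent_linear r x y) | exists 1 => //; exact: Z_bounded].
Qed.

Lemma Ro_inj w : densely_defined T -> Ro w = 0 -> w = 0.
Proof.
move=> dT e; have := Ro_norms w; rewrite e !dotR0r add0r => /esym/dotR_eq0 Z0.
have [_ a] := rT w; rewrite Z0 e subr0 in a.
exact: adjoint_fun dT a (proj1 Al).
Qed.

End Resolvent.

(* For normal [N], R is also (1 + N N^* )^-1, and Z' = N^* R. *)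
Definition normal_resolvent N (Ro Z Z' : H -> H) :=
  resolvent N Ro Z /\
  forall w, adjoint N (Ro w, Z' w) /\ N (Z' w, w - Ro w).

Lemma normal_resolvent_ex N : normal_operator N ->
  exists Ro Z Z', normal_resolvent N Ro Z Z'.
Proof.
move=> [dN cN eN]; have [Ro [Z rN]] := resolvent_ex cN.
have /choice[Z' Z'P] w : exists y, adjoint N (Ro w, y) /\ N (y, w - Ro w).
  have [a1 a2] := rN w; have : (adjoint N *o N) (Ro w, w - Ro w) by exists (Z w).
  by rewrite -eN => -[/= y b1 b2]; exists y.
by exists Ro, Z, Z'.
Qed.

(** * Bounded maps attached to a normal operator *)

Section Normal.
Variables (N : set (H * H)) (Ro Z Z' : H -> H).
Hypotheses (nN : normal_operator N) (nrN : normal_resolvent N Ro Z Z').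

Let oN : is_operator N. Proof. by case: nN => _ []. Qed.
Let Nl := operator_linear oN.
Let Al := adjoint_linear N.
Let dN : densely_defined N. Proof. by case: nN. Qed.
Let rN : resolvent N Ro Z. Proof. by case: nrN. Qed.
Let rN' : forall w, adjoint N (Ro w, Z' w) /\ N (Z' w, w - Ro w).
Proof. by case: nrN. Qed.

Lemma resolvent_adjoint_eq x y z : adjoint N (x, y) -> N (y, z) -> Ro (x + z) = x /\ Z' (x + z) = y.
Proof.
move=> h1 h2; have : (N *o adjoint N) (x, z) by exists y.
case: nN => _ _ -> [/= y0 k1 k2]; have [e1 e2] := resolvent_eq oN rN k1 k2; split=> //.
have [k3 _] := rN' (x + z); rewrite e1 in k3.
exact: adjoint_fun k3 h1.
Qed.

Lemma Z_adj w v : dotR (Z w) v = dotR w (Z' v).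
Proof.
have [a1 a2] := rN w; have [b3 b4] := rN' v.
have := adjoint_dotR b3 a1; have := adjoint_dotR a2 b4.
by rewrite !dotRE (dotRC (Z w) v) (dotRC (Z w) (Ro v)) (dotRC w) (dotRC (Ro w)); lra.
Qed.

Lemma normal_resolventE x y : N (x, y) -> Ro y = Z x /\ Z' y = x - Ro x.
Proof.
by move=> h; have [a1 a2] := rN x; have := resolvent_adjoint_eq a2 (relationB Nl h a1); rewrite subrKC.
Qed.

Lemma adjoint_resolventE x y : adjoint N (x, y) -> Ro y = Z' x /\ Z y = x - Ro x.
Proof.
by move=> h; have [a3 a4] := rN' x; have := resolvent_eq oN rN a4 (relationB Al h a3); rewrite subrKC.
Qed.

(** This turns membership in an unbounded graph into an equation between bounded maps, so what
    commutes with R and Z leaves N invariant. *)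
Lemma normal_iff x y : N (x, y) <-> Ro y = Z x.
Proof.
split=> [/normal_resolventE[] // | e].
have [a1 a2] := rN x; have [b3 b4] := rN' y.
rewrite e in b3 b4; rewrite -(adjoint_fun dN a2 b3) in b4.
by have := relationD Nl a1 b4; rewrite !subrKC.
Qed.

Lemma adjoint_iff x y : adjoint N (x, y) <-> Ro y = Z' x.
Proof.
split=> [/adjoint_resolventE[] // | e].
have [a3 a4] := rN' x; have [b1 b2] := rN y; have [Nf _ _] := oN.
rewrite e in b1 b2; rewrite -(Nf _ _ _ a4 b1) in b2.
by have := relationD Al a3 b2; rewrite !subrKC.
Qed.

Lemma Ro_Z x : Ro (Z x) = Z (Ro x).
Proof. by have [/normal_resolventE[]] := rN x. Qed.
Lemma Ro_Z' x : Ro (Z' x) = Z' (Ro x).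
Proof. by have [/adjoint_resolventE[]] := rN' x. Qed.
Lemma Z'_Z x : Z' (Z x) = Ro x - Ro (Ro x).
Proof. by have [/normal_resolventE[]] := rN x. Qed.
Lemma Z_Z' x : Z (Z' x) = Z' (Z x).
Proof. by rewrite Z'_Z; have [/adjoint_resolventE[]] := rN' x. Qed.

Lemma normal_invariant f : commutes f Ro -> commutes f Z ->
  forall x y, N (x, y) -> N (f x, f y).
Proof. by move=> fR fZ x y /normal_iff e; apply/normal_iff; rewrite -fR e fZ. Qed.

Lemma Z'_linear : real_linear Z'.
Proof.
by move=> r x y; apply: dotR_ext => z; rewrite !dotRE !(dotRC (Z' _)) -!Z_adj !dotRE.
Qed.

Lemma Z_norm w : dotR (Z w) (Z w) = dotR (Z' w) (Z' w).
Proof. by rewrite Z_adj -Z_Z' dotRC Z_adj. Qed.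

Lemma Z'_bounded_map : bounded_map Z'.
Proof.
split; [exact: Z'_linear | exists 1 => // w; rewrite mul1r].
by apply: nrm_le; rewrite -Z_norm !dotR_nrm ler_sqr ?nnegrE ?nrm_ge0 //;
  have := Z_bounded rN w; rewrite mul1r.
Qed.

Lemma Z'_i x : Z' (imul x) = imul (Z' x).
Proof.
apply: dotR_ext => y; rewrite (dotRC _ y) -Z_adj dotRC !dotRiC; congr (- _).
by rewrite -(proj2 (resolvent_imul oN rN _)) dotRC Z_adj dotRC.
Qed.

End Normal.
End Graphs.

(** * Bounded maps, limits of graphs and the closure of a product *)

Section Commuting.
Variables (R : realType) (H : hilbertType R).
Implicit Types (x y z u v w : H) (r : R) (M T N A : set (H * H)) (f h S B : H -> H).

Lemma bounded_mapD f h : bounded_map f -> bounded_map h -> bounded_map (fun x => f x + h x).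
Proof.
move=> [fl [a a0 fa]] [hl [b b0 hb]]; split.
  by move=> r x y; rewrite fl hl; apply: dotR_ext => z; rewrite !dotRE; ring.
exists (a + b) => [|x]; first exact: addr_ge0.
by have := nrmD (f x) (h x); have := fa x; have := hb x; lra.
Qed.

Lemma bounded_mapN f : bounded_map f -> bounded_map (fun x => - f x).
Proof.
move=> [fl [a a0 fa]]; split; last by exists a => // x; rewrite nrmN.
by move=> r x y; rewrite fl; apply: dotR_ext => z; rewrite !dotRE; ring.
Qed.

Lemma bounded_map_comp f h : bounded_map f -> bounded_map h -> bounded_map (fun x => f (h x)).
Proof.
move=> [fl [a a0 fa]] [hl [b b0 hb]]; split=> [r x y|]; first by rewrite hl fl.
exists (a * b) => [|x]; first exact: mulr_ge0.
by apply: le_trans (fa _) _; rewrite -mulrA; apply: ler_wpM2l.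
Qed.

Lemma rscale_bounded r : bounded_map (@rscale R H r).
Proof.
split; first by move=> t x y; apply: dotR_ext => z; rewrite !dotRE; ring.
by exists `|r| => // x; rewrite nrm_rscale.
Qed.

Lemma id_bounded : bounded_map (fun x : H => x).
Proof. by split=> //; exists 1 => // x; rewrite mul1r. Qed.

(** Nonnegativity of the form is a closed condition on pairs, so it passes to closures of graphs. *)
Lemma nonneg_adherent p : adherent [set q : H * H | 0 <= dotR q.2 q.1] p -> 0 <= dotR p.2 p.1.
Proof.
case: p => x y h /=; rewrite -oppr_le0.
apply: (@le_small _ _ _ (1 + nrm x + nrm y)) => n.
have [[x' y'] /= pq [xx yy]] := h _ (eps_gt0 R n).
have e1 : eps n <= 1 :> R by rewrite /eps invf_le1 ?ltr0Sn // ler1n.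
have nx : nrm x' <= 1 + nrm x.
  by have := nrm_triangle x x' 0; rewrite !subr0 nrm_distC; lra.
have e : dotR y' x' = dotR y x - dotR (y - y') x' - dotR y (x - x') by rewrite !dotRE; ring.
have := cauchy_schwarz (y - y') x'; have := cauchy_schwarz y (x - x').
rewrite !ler_norml => /andP[h1 _] /andP[h2 _]; rewrite e in pq.
have k1 : nrm y * nrm (x - x') <= nrm y * eps n.
  by apply: ler_wpM2l; [exact: nrm_ge0 | exact: ltW].
have k2 : nrm (y - y') * nrm x' <= eps n * (1 + nrm x).
  by apply: ler_pM; rewrite ?nrm_ge0 // ltW.
lra.
Qed.

Lemma pos_limit f x : bounded_map f ->
  (forall r, 0 < r -> exists2 y, nrm (x - y) < r & 0 <= dotR (f y) y) -> 0 <= dotR (f x) x.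
Proof.
move=> [fl [a a0 fa]] lim; apply: (nonneg_adherent (p := (x, f x))) => r r0.
have a1 : 0 < a + 1 by lra.
have [|y] := lim (Num.min r (r / (a + 1))); first by rewrite lt_min r0 divr_gt0.
rewrite lt_min ltr_pdivlMr // => /andP[xy1 xy2] fy; exists (y, f y) => //=.
split=> //; rewrite -real_linearB //; have := fa (x - y); have := nrm_ge0 (x - y); lra.
Qed.

Lemma adherent_subspace M : real_subspace M -> real_subspace [set p | adherent M p].
Proof.
move=> [M0 Ml]; split=> [r r0 | r x y x' y' h h' e e0].
  by exists (0, 0) => //; rewrite subrr nrm0.
have k0 : 0 < e / 2 / (`|r| + 1) by rewrite !divr_gt0 // ltr_wpDl.
have [[a b] /= Mab [xa yb]] := h _ k0.
have [|[a' b'] /= Mab' [xa' yb']] := h' (e / 2); first by rewrite divr_gt0.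
exists (rscale r a + a', rscale r b + b'); first exact: Ml.
suff aux (s s' t t' : H) : nrm (s - t) < e / 2 / (`|r| + 1) -> nrm (s' - t') < e / 2 ->
  nrm (rscale r s + s' - (rscale r t + t')) < e by split; exact: aux.
rewrite ltr_pdivlMr ?ltr_wpDl // => h1 h2.
have -> : rscale r s + s' - (rscale r t + t') = rscale r (s - t) + (s' - t').
  by apply: dotR_ext => z; rewrite !dotRE; ring.
apply: le_lt_trans (nrmD _ _) _; rewrite nrm_rscale; have := nrm_ge0 (s - t); lra.
Qed.

Lemma adherent_idem M p : adherent [set q | adherent M q] p -> adherent M p.
Proof.
move=> h r r0; have r2 : 0 < r / 2 by rewrite divr_gt0.
have [q /(_ _ r2)[q' Mq' [a1 a2]] [b1 b2]] := h _ r2; exists q' => //.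
by split; [have := nrm_triangle q.1 p.1 q'.1 | have := nrm_triangle q.2 p.2 q'.2]; lra.
Qed.

Lemma adherent_sub M T p : M `<=` T -> adherent M p -> adherent T p.
Proof. by move=> MT h r /h[q /MT]; exists q. Qed.

Lemma adherent_preim A B p : bounded_map B -> adherent [set q | A (B q.1, q.2)] p ->
  adherent A (B p.1, p.2).
Proof.
move=> [Bl [k k0 Bk]] h r r0.
have k1 : 0 < k + 1 by lra.
have e0 : 0 < Num.min r (r / (k + 1)) by rewrite lt_min r0 divr_gt0.
have [q Aq] := h _ e0; rewrite !lt_min ltr_pdivlMr // => -[/andP[_ a1] /andP[a2 _]].
exists (B q.1, q.2) => //=; split=> //; rewrite -real_linearB //.
by have := Bk (p.1 - q.1); have := nrm_ge0 (p.1 - q.1); lra.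
Qed.

(* The residual of [(x, y)] against the closure of [BA] is [(u, v)] with [Bu = 0]
   and [Bv = 0], hence [u] is orthogonal to [dom A] and [v = A (B u) = 0]. *)
Lemma comp_sub_closure A B T : closed_operator A -> densely_defined A ->
  symmetric_map B -> bounded_map B -> (forall x y, A (x, y) -> A (B x, B y)) ->
  (forall p, adherent T p -> T p) -> (forall x y, A (x, y) -> T (x, B y)) ->
  forall x y, A (B x, y) -> T (x, y).
Proof.
move=> [oA /closed_adherent clA] dA Bs Bb BA clT BAT x y Axy.
have Al := operator_linear oA; have Bl := Bb.1.
pose M0 := [set p : H * H | exists2 z, A (p.1, z) & p.2 = B z].
have M0s : real_subspace M0.
  split; first by exists 0; [case: Al | rewrite real_linear0].
  move=> r a b a' b' [c /= Ac ->] [c' /= Ac' ->].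
  by exists (rscale r c + c'); [apply: (relationD Al) => //; apply: (relation_rscale Al) | rewrite Bl].
pose M := [set p | adherent M0 p].
have M0M p : M0 p -> M p by move=> Mp r r0; exists p => //; rewrite !subrr nrm0.
have MAB p : M p -> A (B p.1, p.2).
  move=> Mp; apply: clA; apply: adherent_preim => //; apply: adherent_sub Mp.
  by case=> a b [c /= Ac ->]; apply: BA.
have [x' [y' [Mx' ho]]] :=
  projection (adherent_subspace M0s) (@adherent_idem M0) x y.
have Auv := relationB Al Axy (MAB _ Mx'); rewrite /= -real_linearB // in Auv.
set u := x - x' in Auv ho; set v := y - y' in Auv ho.
(* [Auv] says A (B u) = v, so invariance gives A (B (B u)) = B v. Orthogonality of the residual to
   the resulting pair of BA reads |B u|^2 + |B v|^2 = 0. *)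
have BBM : M (B (B u), B (B v)).
  by apply: M0M; exists (B v) => //=; apply: BA.
have := ho _ _ BBM; rewrite -(Bs u) -(Bs v) => s0.
have Bv0 : B v = 0.
  by apply: dotR_eq0; have := dotR_ge0 (B u); have := dotR_ge0 (B v); lra.
have u0 : u = 0.
  apply: (dense_orth0 dA) => a [b Aab].
  have /ho : M (a, B b) by apply: M0M; exists b.
  by rewrite -Bs Bv0 dotR0l addr0 dotRC.
have v0 : v = 0.
  have [Af A0 _] := oA; apply: Af A0.
  by move: Auv; rewrite u0 real_linear0.
have -> : x = x' by apply/eqP; rewrite -subr_eq0 -/u u0.
have -> : y = y' by apply/eqP; rewrite -subr_eq0 -/v v0.
by apply: clT; apply: adherent_sub Mx' => -[a b] [c /= Ac ->]; apply: BAT.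
Qed.

End Commuting.

(** * Normal products are self-adjoint *)

Section HalfPlane.
Variables (R : realType) (H : hilbertType R).
Implicit Types (x y z u v w : H) (r : R).

Section Operators.
Variables (B Ro W J J' L : H -> H).
Hypotheses (Bs : symmetric_map B) (Bp : positive_map B) (Bb : bounded_map B).
Hypotheses (Rs : symmetric_map Ro) (Rp : positive_map Ro) (Rb : bounded_map Ro) (R0 : forall w, Ro w = 0 -> w = 0).
Hypotheses (Ws : symmetric_map W) (Wb : bounded_map W).
Hypotheses (Jb : bounded_map J) (J'b : bounded_map J') (Lb : bounded_map L).
Hypotheses (JJ' : forall x y, dotR (J x) y = dotR x (J' y)).
Hypotheses (JW : commutes J W) (J'W : commutes J' W) (LW : commutes L W) (RW : commutes Ro W).
Hypotheses (Jn : forall w, dotR (J w) (J w) = dotR w (Ro w) + 2 * dotR (W w) (Ro w)).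
Hypotheses (J'n : forall w, dotR (J' w) (J' w) = dotR w (Ro w) + 2 * dotR (W w) (Ro w)).
Hypotheses (Ln : forall w, dotR (L w) (L w) = dotR w (Ro w) - 2 * dotR (W w) (Ro w)).
Hypothesis BJL : forall w, dotR (B (J w)) (J w) = dotR (B (L w)) (L w).
Hypothesis BR0 : forall w, B (Ro w) = 0 -> dotR (W w) w = 0.

(* For a normal N with R = (1 + N^*N)^-1 this is applied to J = (N + i) R,
   L = (N - i) R and W = Im (N R).  Let F be the spectral subspace W >= d > 0.
   There |J w|^2 >= (1 + 4d) |L w|^2, J has dense range, and the form of B takes
   the same value at J w and L w.  Hence it vanishes on F, so F = 0. *)
Lemma half_plane x : dotR (W x) x <= 0.
Proof.
have Wl := Wb.1; have Bl := Bb.1; have Jl := Jb.1.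
(* It suffices to prove W <= d for each d = [eps n]. *)
apply: (@le_small _ _ _ (dotR x x)) => n; rewrite add0r.
have d0 := eps_gt0 R n; move: (eps n) d0 => d d0.
pose U y := W y - rscale d y.
have Us : symmetric_map U by move=> y z; rewrite /U !dotRE Ws.
have Ub : bounded_map U by apply: bounded_mapD => //; apply: bounded_mapN; apply: rscale_bounded.
have Ul := Ub.1.
have SU S : bounded_map S -> commutes S W -> commutes S U.
  by move=> [Sl _] SW y; rewrite /U real_linearB // SW real_linearZ.
have [|||Q [Qs Qp Qb QQ Qc]] := @sqrt_pos _ _ (fun y => U (U y)).
- by move=> y z; rewrite !Us.
- by move=> y; rewrite Us dotR_ge0.
- by have [_ ?] := bounded_map_comp Ub Ub.
have Ql := symmetric_map_linear Qs.
have QU : commutes U Q by apply: Qc.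
(* Q is |U|, so F is the spectral subspace of U >= 0. Bounded maps that commute with W commute with
   both U and Q, hence preserve F. *)
pose F := [set w | Q w = U w].
have FS S w : bounded_map S -> commutes S W -> F w -> F (S w).
  move=> Sb SW Fw; have SUc := SU S Sb SW.
  by rewrite /F /= -(Qc S) // ?Fw ?SUc // => y; rewrite !SUc.
have FW w : F w -> d * dotR w w <= dotR (W w) w.
  move=> Fw; have := Qp w; rewrite Fw /U !dotRE; lra.
(* The root C of R turns <W w, R w> into <W C w, C w>, and C w stays in F, where W >= d. *)
have [C [Cs Cp [k k0 Cb] CC Cc]] := sqrt_pos Rs Rp Rb.2.
have CbW : bounded_map C by split; [exact: symmetric_map_linear | exists k].
have CW : commutes C W by move=> y; apply/esym/Cc => // z; apply/esym/RW.
have WR w : dotR (W w) (Ro w) = dotR (W (C w)) (C w) by rewrite -CC -Cs -CW.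
have RCC w : dotR w (Ro w) = dotR (C w) (C w) by rewrite -CC Cs.
have FWC w : F w -> d * dotR (C w) (C w) <= dotR (W w) (Ro w).
  by move=> Fw; rewrite WR; apply: FW; apply: FS.
(* With a = |C w|^2 and b = <W w, R w>, the squared norms are a + 2b and a - 2b; the factor 1 + 4d
   comes from d a <= b. *)
have JL w : F w -> (1 + 4 * d) * dotR (L w) (L w) <= dotR (J w) (J w).
  move=> Fw; rewrite Jn Ln RCC; have := FWC w Fw; have := dotR_ge0 (C w).
  move: (dotR (C w) (C w)) (dotR (W w) (Ro w)) => a b a0 ab; nra.
have FJ' w : F w -> J' w = 0 -> w = 0.
  move=> Fw J'w; apply: R0; rewrite -CC.
  have := J'n w; rewrite J'w dotR0l RCC => e; have := FWC w Fw.
  have h := mulr_ge0 (ltW d0) (dotR_ge0 (C w)); have h' := dotR_ge0 (C w) => h2.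
  by rewrite (dotR_eq0 (x := C w)) ?real_linear0 //; [exact: symmetric_map_linear | lra].
have Fclosed w : (forall r, 0 < r -> exists2 y, F y & nrm (w - y) < r) -> F w.
  move=> cl; pose V y := Q y - U y.
  have [Vl [a a0 Va]] : bounded_map V by apply: bounded_mapD => //; apply: bounded_mapN.
  suff : V w = 0 by move/eqP; rewrite subr_eq0 => /eqP.
  apply: (@eq_small_nrm _ _ _ _ a) => m; rewrite subr0.
  have [y Fy wy] := cl _ (eps_gt0 R m).
  have -> : V w = V (w - y) by rewrite (real_linearB _ _ Vl) [V y]/V Fy subrr subr0.
  by apply: le_trans (Va _) _; apply: ler_wpM2l => //; exact: ltW.
have F0 : F 0 by rewrite /F /= !real_linear0.
have Fl r y z : F y -> F z -> F (rscale r y + z).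
  by rewrite /F /= => Fy Fz; rewrite Ql Ul Fy Fz.
(* J F is dense in F: a vector of F orthogonal to J F is killed by J', which is injective on F. *)
have JF w : F w -> forall r, 0 < r -> exists2 y, F y & nrm (w - J y) < r.
  move=> Fw; pose D := [set J y | y in F].
  have [||w' [clw' ow']] := @projection_closure _ _ D _ _ w.
  - by exists 0 => //; rewrite real_linear0.
  - move=> r _ _ [y Fy <-] [z Fz <-]; exists (rscale r y + z); first exact: Fl.
    by rewrite Jl.
  have Fw' : F w'.
    by apply: Fclosed => r /clw'[_ [y Fy <-]]; exists (J y) => //; apply: FS.
  have Fr : F (w - w').
    have -> : w - w' = rscale (-1) w' + w by apply: dotR_ext => z; rewrite !dotRE; ring.
    exact: Fl.
  suff e : w - w' = 0.
    move=> r /clw'[_ [y Fy <-]]; exists y => //.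
    by move/eqP: e; rewrite subr_eq0 => /eqP ->.
  apply: FJ' => //; apply: dotR_eq0.
  by rewrite -JJ' dotRC; apply: ow'; exists (J' (w - w')) => //; apply: FS.
have [K K0 BK] := Bb.2.
(* Each step writes w as a limit of J y and passes to L y, which gains a factor 1 + 4d. The linear
   lower bound 1 + 4dm for the power (Bernoulli) already forces the form to 0. *)
have iter m w : F w -> (1 + 4 * d * m%:R) * dotR (B w) w <= K * dotR w w.
  elim: m w => [|m IH] w Fw.
    rewrite mulr0 addr0 mul1r dotR_nrm expr2 mulrA.
    have := cauchy_schwarz (B w) w; rewrite ler_norml => /andP[_ h]; apply: le_trans h _.
    by apply: ler_wpM2r; rewrite ?nrm_ge0.
  pose T y := rscale K y - rscale (1 + 4 * d * m.+1%:R) (B y).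
  have Tb : bounded_map T.
    apply: bounded_mapD; first exact: rscale_bounded.
    by apply: bounded_mapN; apply: bounded_map_comp => //; apply: rscale_bounded.
  rewrite -subr_ge0; suff : 0 <= dotR (T w) w by rewrite /T !dotRE.
  apply: pos_limit => // r /(JF _ Fw)[y Fy wy]; exists (J y) => //.
  rewrite /T !dotRE subr_ge0 BJL.
  have h1 := IH _ (FS L y Lb LW Fy); have h2 := JL y Fy; have h3 := Bp (L y).
  have := ler_wpM2l K0 h2; have m0 : 0 <= m%:R :> R by rewrite ler0n.
  rewrite -natr1; move: (dotR (B _) _) h1 h3 => q h1 h3.
  have c0 : 0 <= 1 + 4 * d by lra.
  have := ler_wpM2l c0 h1; have p1 : 0 <= d * m%:R by apply: mulr_ge0 => //; exact: ltW.
  have := mulr_ge0 h3 (mulr_ge0 (ltW d0) p1).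
  lra.
have Bq w : F w -> B w = 0.
  move=> Fw; apply: pos_ker => //; apply/eqP; rewrite eq_le Bp andbT.
  apply: (@le_small _ _ _ (K * dotR w w / (4 * d))) => m; rewrite add0r.
  have := iter m.+1 w Fw; have := Bp w => q0 h.
  rewrite /eps ler_pdivlMr ?ltr0Sn // ler_pdivlMr; last lra.
  lra.
(* R w is in F, so B R w = 0 and [BR0] gives <W w, w> = 0, against W >= d on F. *)
have Fnil w : F w -> w = 0.
  move=> Fw; apply: dotR_eq0; apply/eqP; rewrite eq_le dotR_ge0 andbT.
  have := FW w Fw; rewrite BR0; last by apply: Bq; apply: FS.
  by move=> h; rewrite -(ler_pM2l d0) mulr0.
(* Since Q^2 = U^2 and Q U = U Q, the range of Q + U lies in F = 0. Thus U = - Q <= 0. *)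
have : F (Q x + U x).
  by rewrite /F /= (real_linearD _ _ Ql) (real_linearD _ _ Ul) QQ QU addrC.
move=> /Fnil/eqP; rewrite addr_eq0 => /eqP e.
have := Qp x; rewrite e dotRNl /U !dotRE; lra.
Qed.
End Operators.
End HalfPlane.

Section NormalProduct.
Variables (R : realType) (H : hilbertType R) (A : set (H * H)) (B : H -> H).
Implicit Types (x y z u v w : H) (r : R).
Hypotheses (sA : symmetric_operator A) (Bs : symmetric_map B) (Bp : positive_map B) (Bb : bounded_map B).
Hypothesis (Bi : forall x, B (imul x) = imul (B x)).

Let N := A *o graph B.

Lemma comp_graphE x y : N (x, y) <-> A (B x, y).
Proof. by split=> [[z] | h]; [rewrite /graph /= => -> | exists (B x)]. Qed.

Lemma comp_real x y : N (x, y) -> dotR (B y) (imul x) = 0.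
Proof. by move=> /comp_graphE Axy; rewrite Bs Bi (symmetric_real sA Axy). Qed.

Lemma normal_comp_self_adjoint : normal_operator N -> N = adjoint N.
Proof.
move=> nN; have [Ro [Z [Z' nrN]]] := normal_resolvent_ex nN.
have [dN [oN _] _] := nN; have [rN _] := nrN.
have Ri x : Ro (imul x) = imul (Ro x) by case: (resolvent_imul oN rN x).
have Zi x : Z (imul x) = imul (Z x) by case: (resolvent_imul oN rN x).
have Z'i := Z'_i nN nrN.
have [[Rb Zb] Z'b] := (Ro_bounded_map oN rN, Z_bounded_map oN rN, Z'_bounded_map nN nrN).
have [[Rl Zl] Z'l] := (Rb.1, Zb.1, Z'b.1).
have Rs := Ro_sym rN.
have RZ := Ro_Z nN nrN; have RZ' := Ro_Z' nN nrN; have ZZ' := Z_Z' nN nrN.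
have ib := @imul_bounded R H; have il := ib.1.
have iRb : bounded_map (fun x => imul (Ro x)) by apply: bounded_map_comp.
(* This is (Z - Z') / (2i), the imaginary part of Z, since Z' is the adjoint of Z. *)
pose W x := rscale 2^-1 (imul (Z' x - Z x)).
have Wb : bounded_map W.
  apply: bounded_map_comp; first exact: rscale_bounded.
  by apply: bounded_map_comp => //; apply: bounded_mapD => //; apply: bounded_mapN.
have Ws : symmetric_map W.
  move=> x y; rewrite /W !dotRE dotRiC dotRBl (Z_adj nrN) (dotRC (Z' x)) -(Z_adj nrN).
  by rewrite Zi Z'i (real_linearB _ _ il) !dotRE (dotRC _ x); lra.
pose J x := Z x + imul (Ro x); pose J' x := Z' x - imul (Ro x).
pose L x := Z x - imul (Ro x); pose L' x := Z' x + imul (Ro x).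
have Jb : bounded_map J by apply: bounded_mapD.
have J'b : bounded_map J' by apply: bounded_mapD => //; apply: bounded_mapN.
have Lb : bounded_map L by apply: bounded_mapD => //; apply: bounded_mapN.
have L'b : bounded_map L' by apply: bounded_mapD.
have comm S : bounded_map S -> (forall x, S (imul x) = imul (S x)) ->
    (forall x, S (Z x) = Z (S x)) -> (forall x, S (Z' x) = Z' (S x)) -> commutes S W.
  by move=> [Sl _] Si SZ SZ' x; rewrite /W real_linearZ // Si real_linearB // SZ SZ'.
have RW : commutes Ro W by apply: comm.
have iRZ x : imul (Ro (Z x)) = Z (imul (Ro x)) by rewrite RZ Zi.
have iRZ' x : imul (Ro (Z' x)) = Z' (imul (Ro x)) by rewrite RZ' Z'i.
have JW : commutes J W.
  apply: comm => // x; rewrite /J.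
  - by rewrite Zi Ri -(real_linearD _ _ il).
  - by rewrite iRZ real_linearD.
  - by rewrite iRZ' ZZ' real_linearD.
have LW : commutes L W.
  apply: comm => // x; rewrite /L.
  - by rewrite Zi Ri -(real_linearB _ _ il).
  - by rewrite iRZ real_linearB.
  - by rewrite iRZ' ZZ' real_linearB.
have J'W : commutes J' W.
  apply: comm => // x; rewrite /J'.
  - by rewrite Z'i Ri -(real_linearB _ _ il).
  - by rewrite iRZ -ZZ' real_linearB.
  - by rewrite iRZ' real_linearB.
have L'W : commutes L' W.
  apply: comm => // x; rewrite /L'.
  - by rewrite Z'i Ri -(real_linearD _ _ il).
  - by rewrite iRZ -ZZ' real_linearD.
  - by rewrite iRZ' real_linearD.
have JJ' x y : dotR (J x) y = dotR x (J' y).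
  by rewrite /J /J' !dotRE (Z_adj nrN) dotRiC Rs Ri; lra.
have LL' x y : dotR (L x) y = dotR x (L' y).
  by rewrite /L /L' !dotRE (Z_adj nrN) dotRiC Rs Ri; lra.
have ii x y : dotR (imul x) (imul y) = dotR x y by rewrite dotRiC imul_imul dotRNr opprK.
have ZZi w : dotR (Z' w) (imul (Ro w)) = - dotR (Z w) (imul (Ro w)).
  by rewrite dotRC -(Z_adj nrN) Zi dotRiC -RZ Rs Ri.
have WR w : 2 * dotR (W w) (Ro w) = 2 * dotR (Z w) (imul (Ro w)).
  by rewrite /W !dotRE dotRiC dotRBl ZZi; lra.
have RN w := Ro_norms rN w.
have Jn w : dotR (J w) (J w) = dotR w (Ro w) + 2 * dotR (W w) (Ro w).
  by rewrite WR RN /J !dotRE ii (dotRC (imul _)); lra.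
have Ln w : dotR (L w) (L w) = dotR w (Ro w) - 2 * dotR (W w) (Ro w).
  by rewrite WR RN /L !dotRE ii (dotRC (imul _)); lra.
have J'n w : dotR (J' w) (J' w) = dotR w (Ro w) + 2 * dotR (W w) (Ro w).
  by rewrite WR RN (Z_norm nN nrN) /J' !dotRE ii (dotRC (imul _)) ZZi; lra.
have L'n w : dotR (L' w) (L' w) = dotR w (Ro w) - 2 * dotR (W w) (Ro w).
  by rewrite WR RN (Z_norm nN nrN) /L' !dotRE ii (dotRC (imul _)) ZZi; lra.
(* The two sides differ only in the sign of the cross term <B Z w, i R w>, whose real part vanishes
   by [comp_real]. *)
have BJL w : dotR (B (J w)) (J w) = dotR (B (L w)) (L w).
  have [a _] := rN w; have := comp_real a.
  rewrite /J /L (real_linearD _ _ Bb.1) (real_linearB _ _ Bb.1) !dotRE (Bs (imul _) (Z w)).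
  by rewrite (dotRC (imul (Ro w)) (B _)); lra.
have BR0 w : B (Ro w) = 0 -> dotR (W w) w = 0.
  move=> BRw; have [a _] := rN w; move/comp_graphE: a; rewrite BRw => a.
  have Zw : Z w = 0 by have [[Af A0 _] _ _] := sA; apply: Af A0.
  by rewrite /W !dotRE dotRiC dotRBl (dotRC (Z' w)) -(Z_adj nrN) Zi Zw !dotRE real_linear0 // !dotRE; lra.
have R0 w := @Ro_inj _ _ _ _ _ rN w dN; have Rp := Ro_pos rN.
have W0 x : dotR (W x) x = 0.
  apply/eqP; rewrite eq_le (half_plane Bs Bp Bb Rs Rp Rb R0 Ws Wb Jb J'b Lb JJ'
    JW J'W LW RW Jn J'n Ln BJL BR0) /=.
  (* For the lower half plane W is replaced by - W, and the pairs J, J' and L, L' exchange roles. *)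
  have NWs : symmetric_map (fun x => - W x) by move=> u v; rewrite dotRNl dotRNr Ws.
  have cN S : bounded_map S -> commutes S W -> commutes S (fun x => - W x).
    by move=> [Sl _] SW u; rewrite real_linearN // SW.
  rewrite -oppr_le0 -dotRNl.
  apply: (half_plane Bs Bp Bb Rs Rp Rb R0 NWs (bounded_mapN Wb) Lb L'b Jb LL'
    (cN _ Lb LW) (cN _ L'b L'W) (cN _ Jb JW) (cN _ Rb RW)) => w.
  - by rewrite Ln dotRNl; lra.
  - by rewrite L'n dotRNl; lra.
  - by rewrite Jn dotRNl; lra.
  - by rewrite BJL.
  - by move=> /BR0 h; rewrite dotRNl h oppr0.
have ZE x : Z x = Z' x.
  have : W x = 0 by apply: pos_ker => // y; rewrite W0.
  move=> e; apply/eqP; rewrite eq_sym -subr_eq0; apply/eqP/dotR_eq0.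
  rewrite -ii; have : imul (Z' x - Z x) = rscale 2 (W x).
    by apply: dotR_ext => z; rewrite /W !dotRE; lra.
  by rewrite e => ->; rewrite !dotRE !mulr0.
(* N and its adjoint are the relations R y = Z x and R y = Z' x with the same R. *)
apply/seteqP; split=> -[x y].
  by move/(normal_iff nN nrN); rewrite ZE => /(adjoint_iff nN nrN).
by move/(adjoint_iff nN nrN); rewrite -ZE => /(normal_iff nN nrN).
Qed.

End NormalProduct.

(** * The modulus *)

Section Modulus.
Variables (R : realType) (H : hilbertType R).
Implicit Types (x y z u v w : H) (r : R) (A P T : set (H * H)).

Lemma scale_re_im (a : R[i]) x : a *: x = rscale (complex.Re a) x + rscale (complex.Im a) (imul x).
Proof.
by rewrite {1}(complexE a) scalerDl /rscale /imul scalerA [_%:C * _]mulrC.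
Qed.

Lemma real_linear_complex f (a : R[i]) x y : real_linear f -> (forall x : H, f (imul x) = imul (f x)) ->
  f (a *: x + y) = a *: f x + f y.
Proof. by move=> fl fi; rewrite !scale_re_im !(real_linearD _ _ fl) !(real_linearZ _ _ fl) fi. Qed.

Lemma symmetric_positive T : symmetric_operator T ->
  (forall x y, T (x, y) -> 0 <= dotR y x) -> positive_operator T.
Proof.
move=> sT pT; split=> // x y Txy.
by rewrite inner_dotR (symmetric_real sT Txy) ler0c; apply: pT.
Qed.

Lemma positive_dotR T x y : positive_operator T -> T (x, y) -> 0 <= dotR y x.
Proof. by case=> _ /[apply]; rewrite inner_dotR lecE /= => /andP[]. Qed.

Lemma self_adjoint_symmetric T : self_adjoint T -> symmetric_operator T.
Proof. by case=> oT dT eT; split=> //; rewrite -eT. Qed.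

(* With C = sqrt R and S = sqrt (1 - R) for R = (1 + A^*A)^-1, the modulus is
   S C^-1, that is the relation [C u |-> S u]. *)
Lemma modulus_exists A : closed_operator A -> densely_defined A ->
  exists P, [/\ self_adjoint P, positive_operator P & P *o P = adjoint A *o A].
Proof.
move=> cA dA; have [oA _] := cA; have [Ro [Z rA]] := resolvent_ex cA.
have [[Rs Rp] Rb] := (Ro_sym rA, Ro_pos rA, Ro_bounded_map oA rA).
have Rl := Rb.1; have R0 w := @Ro_inj _ _ _ _ _ rA w dA.
have Ri x : Ro (imul x) = imul (Ro x) by case: (resolvent_imul oA rA x).
have [C [Cs Cp Cb CC Cc]] := sqrt_pos Rs Rp Rb.2.
pose D x := x - Ro x.
have Ds : symmetric_map D by move=> x y; rewrite /D dotRBl dotRBr Rs.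
have Dp : positive_map D.
  move=> x; rewrite /D dotRBl subr_ge0; have := cauchy_schwarz (Ro x) x.
  rewrite ler_norml dotR_nrm => /andP[_ h]; apply: le_trans h _; rewrite expr2.
  by apply: ler_wpM2r; [exact: nrm_ge0 | have := Ro_bounded rA x; rewrite mul1r].
have Db : bounded_map D by apply: bounded_mapD; [exact: id_bounded | exact: bounded_mapN].
have [S [Ss Sp Sb SS Sc]] := sqrt_pos Ds Dp Db.2.
have Cl := symmetric_map_linear Cs; have Sl := symmetric_map_linear Ss.
have bC : bounded_map C by []. have bS : bounded_map S by [].
have iR : commutes (@imul R H) Ro by move=> x.
have iD : commutes (@imul R H) D by move=> x; rewrite /D (real_linearB _ _ (@imul_linear R H)) Ri.
have Ci x : C (imul x) = imul (C x) by rewrite (Cc _ (@imul_bounded R H) iR).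
have Si x : S (imul x) = imul (S x) by rewrite (Sc _ (@imul_bounded R H) iD).
have RD : commutes Ro D by move=> x; rewrite /D (real_linearB _ _ Rl).
have RS : commutes Ro S by apply: Sc.
have SC : commutes S C by apply: Cc => // x; rewrite RS.
have CCS x : C (C x) + S (S x) = x by rewrite CC SS subrKC.
pose P := [set p : H * H | exists2 u, p.1 = C u & p.2 = S u].
have PE u : P (C u, S u) by exists u.
have oP : is_operator P.
  split.
  - move=> x y z [/= u -> ->] [/= v uv ->]; congr (S _).
    apply/eqP; rewrite -subr_eq0; apply/eqP/R0.
    by rewrite -CC (real_linearB _ _ Cl) uv subrr real_linear0.
  - by exists 0; rewrite /= real_linear0.
  - move=> a x y x' y' [/= u -> ->] [/= u' -> ->]; exists (a *: u + u') => /=;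
      by rewrite real_linear_complex.
have eP : P = adjoint P.
  apply/seteqP; split=> -[x y].
    move=> [/= u -> ->]; apply/(adjoint_dotRP (operator_linear oP)) => _ _ [/= v -> ->].
    by rewrite Ss Cs SC.
  move=> aP; have e : S x = C y.
    by apply: dotR_ext => u; rewrite Ss Cs dotRC (adjoint_dotR aP (PE u)) dotRC.
  (* The witness comes from C^2 + S^2 = 1: with S x = C y, both x = C (C x + S y) and y = S (C x + S
     y). *)
  exists (C x + S y) => /=.
    by rewrite real_linearD // -SC -e CCS.
  by rewrite real_linearD // SC e CCS.
have dP : densely_defined P.
  have domP u : dom P (C u) by exists (S u).
  apply: dense_orth.
  - by rewrite -(real_linear0 Cl).
  - move=> r _ _ [_ [/= u -> _]] [_ [/= v -> _]]; by rewrite -Cl.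
  - move=> x ox; apply: R0; rewrite -CC; have -> : C x = 0.
      by apply: dotR_ext => u; rewrite Cs ox // dotR0l.
    exact: real_linear0.
have sP : self_adjoint P by [].
exists P; split=> //.
  apply: symmetric_positive; first exact: self_adjoint_symmetric.
  move=> _ _ [/= u -> ->]; rewrite -Cs.
  exact: (@pos_comp _ _ C S Cs Cp Cb Ss Sp bS SC).
apply/seteqP; split=> -[x z].
  move=> [/= _ [/= u -> ->] [/= v e ->]].
  (* C u + S v is x + z, so z = A^*A x amounts to R sending it to x. From S u = C v one gets C (C u
     + S v) = u. *)
  have Rw : Ro (C u + S v) = C u.
    by rewrite -CC; congr (C _); rewrite real_linearD // -SC -e CCS.
  have [a1 a2] := rA (C u + S v); exists (Z (C u + S v)) => /=; first by rewrite -{1}Rw.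
  by move: a2; rewrite Rw addrAC subrr add0r.
move=> [/= y a1 a2]; have [e _] := resolvent_eq oA rA a1 a2.
have xE : x = C (C (x + z)) by rewrite CC e.
have zE : z = S (S (x + z)) by rewrite SS /D e addrAC subrr add0r.
exists (S (C (x + z))) => /=.
  by rewrite {1}xE; exact: PE.
by rewrite SC {2}zE; exact: PE.
Qed.

Lemma abs_opP A : closed_operator A -> densely_defined A ->
  [/\ self_adjoint (abs_op A), positive_operator (abs_op A) &
    abs_op A *o abs_op A = adjoint A *o A].
Proof. by move=> cA dA; have := xgetPex set0 (modulus_exists cA dA). Qed.

End Modulus.

(** * Products of a closed operator with a bounded symmetric one *)

Section Products.
Variables (R : realType) (H : hilbertType R) (A : set (H * H)) (B : {linear H -> H}).
Implicit Types (x y z u v w : H) (r : R).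

Lemma linear_real_linear : real_linear B.
Proof. by move=> r x y; rewrite linearP. Qed.

Lemma linear_imul x : B (imul x) = imul (B x).
Proof. by rewrite linearZ. Qed.

Lemma bounded_operator_map : bounded_operator B -> bounded_map B.
Proof.
move=> [[a b] Mb]; split; first exact: linear_real_linear.
exists `|a| => // x; have := Mb x; rewrite !normE lecE /= => /andP[_].
rewrite mulr0 subr0 => h; apply: le_trans h _; apply: ler_wpM2r; first exact: nrm_ge0.
exact: ler_norm.
Qed.

Lemma graph_symmetric : symmetric_operator (graph B) -> symmetric_map B.
Proof.
move=> [_ _ sB] x y; have /sB h : graph B (y, B y) by [].
by rewrite (adjoint_dotR (u := x) (v := B x) h).
Qed.

Lemma graph_positive : positive_operator (graph B) -> symmetric_map B /\ positive_map B.
Proof.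
move=> pB; have [/graph_symmetric Bs _] := pB; split=> // x.
exact: (positive_dotR pB).
Qed.

Lemma comp_operator : is_operator A -> is_operator (A *o graph B).
Proof.
move=> [Af A0 Al]; split.
- by move=> x y z /comp_graphE h1 /comp_graphE h2; apply: Af h1 h2.
- by apply/comp_graphE; rewrite linear0.
- move=> a x y x' y' /comp_graphE h1 /comp_graphE h2; apply/comp_graphE.
  by rewrite linearP; apply: Al.
Qed.

Hypotheses (Bb : bounded_map B) (Bs : symmetric_map B).

Section Invariant.
Hypotheses (cA : closed_operator A) (dA : densely_defined A).
Hypothesis BA : forall x y, A (x, y) -> A (B x, B y).

Lemma comp_sub : graph B *o A `<=` A *o graph B.
Proof.
move=> [x z] [y Axy]; rewrite /graph /= => ->.
by apply/comp_graphE; apply: BA.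
Qed.

(** [comp_sub_closure] places AB inside every closed extension of BA, and AB is itself one. *)
Lemma comp_closure : closed_operator (A *o graph B) ->
  op_closure (graph B *o A) = A *o graph B.
Proof.
move=> cAB; apply/seteqP; split; first exact: smallest_sub cAB comp_sub.
move=> [x y] /comp_graphE h T [[oT /closed_adherent clT] BAT].
apply: (comp_sub_closure cA dA Bs Bb BA clT _ h) => u v Auv.
by apply: BAT; exists v.
Qed.

End Invariant.

Lemma self_adjoint_comp : self_adjoint A -> (forall x y, A (x, y) -> A (B x, B y)) ->
  self_adjoint (A *o graph B).
Proof.
move=> sA BA; have [oA dA eA] := sA; have cA := self_adjoint_closed sA.
have oAB := comp_operator oA; split=> //.
  apply/dense_nrm => x r r0; have [y [z Ayz] xy] := (proj1 (dense_nrm _) dA) x r r0.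
  by exists y => //; exists (B z); apply/comp_graphE; apply: BA.
apply/seteqP; split=> -[x y].
  move=> /comp_graphE Axy; apply/(adjoint_dotRP (operator_linear oAB)) => u v /comp_graphE Auv.
  suff h : adjoint [set (x, y)] (u, v) by rewrite dotRC -(adjoint_dotR (u := x) (v := y) h) // dotRC.
  (* Being formally adjoint to the single pair (x, y) is a closed condition on (u, v), so it only
     has to be checked on BA. *)
  apply: (comp_sub_closure cA dA Bs Bb BA (@adjoint_adherent _ _ _) _ Auv) => a b Aab.
  move=> _ _ [-> ->] /=; rewrite eA in Aab; rewrite (Aab _ _ Axy) /=.
  by rewrite !inner_dotR !Bs linear_imul.
move=> aAB; apply/comp_graphE; rewrite eA.
apply/(adjoint_dotRP (operator_linear oA)) => u v Auv; rewrite -Bs.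
by apply: (adjoint_dotR aAB); apply/comp_graphE; apply: BA.
Qed.

End Products.

(** * The product of the modulus with B *)

Section Main.
Variables (R : realType) (H : hilbertType R) (A P : set (H * H)) (B : {linear H -> H}).
Implicit Types (x y z u v w : H) (r : R) (f : H -> H).
Hypotheses (Bb : bounded_map B) (Bs : symmetric_map B).
Hypothesis BA : forall x y, A (x, y) -> A (B x, B y).

Lemma adjoint_invariant x y : is_operator A ->
  adjoint A (x, y) -> adjoint A (B x, B y).
Proof.
move=> oA aA; apply/(adjoint_dotRP (operator_linear oA)) => u v Auv.
by rewrite -!Bs; apply: (adjoint_dotR aA); apply: BA.
Qed.

Hypotheses (sP : self_adjoint P) (pP : positive_operator P).
Hypotheses (oA : is_operator A) (PP : P *o P = adjoint A *o A).

(* [B], hence [f], commutes with R = (1 + P^2)^-1 and with P R, which is the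
   positive square root of R - R^2; and [P (x, y)] iff [R y = P R x]. *)
Lemma modulus_invariant f : bounded_map f -> (forall S : H -> H, bounded_map S -> commutes S B -> commutes f S) ->
  forall x y, P (x, y) -> P (f x, f y).
Proof.
move=> fb fB; have nP := self_adjoint_normal sP; have [oP dP eP] := sP.
have [Ro [Z [Z' nrP]]] := normal_resolvent_ex nP; have [rP _] := nrP.
have [Rb Zb] := (Ro_bounded_map oP rP, Z_bounded_map oP rP).
(* Invariance of P under B is not yet available, but P^2 = A^*A inherits it from A and its adjoint.
   Hence B maps the solution of x + P^2 x = w to the solution for B w. *)
have BR : commutes Ro B.
  move=> w; have [a1 a2] := rP w; rewrite -eP in a2.
  have : (P *o P) (Ro w, w - Ro w) by exists (Z w).
  rewrite PP => -[/= y b1 b2].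
  have : (adjoint A *o A) (B (Ro w), B (w - Ro w)).
    by exists (B y); [exact: BA | exact: adjoint_invariant].
  rewrite -PP => -[/= z c1 c2]; rewrite eP in c2.
  by have [] := resolvent_eq oP rP c1 c2; rewrite linearB subrKC.
have ZZ' w : Z w = Z' w.
  have [a1 _] := rP w; have [_ /(_ w)[a2 _]] := nrP.
  by rewrite -eP in a2; have [Pf _ _] := oP; apply: Pf a1 a2.
have Zs : symmetric_map Z by move=> x y; rewrite (Z_adj nrP) ZZ'.
have Zp : positive_map Z.
  move=> w; have [a1 a2] := rP w; rewrite -eP in a2.
  have := positive_dotR pP a1; have := positive_dotR pP a2.
  by rewrite dotRBl (dotRC w) (dotRC (Ro w)); lra.
have BZZ : commutes B (fun w => Z (Z w)).
  move=> w; rewrite !(ZZ' (Z _)) !(Z'_Z nP nrP) linearB.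
  by rewrite -!BR.
have BZ : commutes B Z := commutes_sqr Zs Zp Zb Bb BZZ.
by apply: (normal_invariant nP nrP); apply: fB => // w; rewrite BZ.
Qed.

(** With Q the root of B, which also preserves P, the form of BP at u is <P Q u, Q u> >= 0; this
    passes to the closure of BP, which contains PB. *)
Lemma modulus_comp_positive : positive_map B -> positive_operator (P *o graph B).
Proof.
move=> Bp; have BP : forall x y, P (x, y) -> P (B x, B y).
  by apply: modulus_invariant => // S _ SB x; rewrite SB.
have [Q [Qs Qp Qb QQ Qc]] := sqrt_pos Bs Bp Bb.2.
have QP : forall x y, P (x, y) -> P (Q x, Q y).
  apply: modulus_invariant; first by split; [exact: symmetric_map_linear|].
  by move=> S Sb SB x; rewrite (Qc S Sb SB).
apply: symmetric_positive; first exact/self_adjoint_symmetric/self_adjoint_comp.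
move=> x y /comp_graphE Pxy; have [_ dP _] := sP.
apply: (comp_sub_closure (T := [set q | 0 <= dotR q.2 q.1])
  (self_adjoint_closed sP) dP Bs Bb BP (@nonneg_adherent _ _) _ Pxy) => u v Puv /=.
by rewrite -QQ Qs; apply: (positive_dotR pP); apply: QP.
Qed.

End Main.


Theorem theorem2p5 (R : realType) (H : hilbertType R) (A : set (H * H))
    (B : {linear H -> H}) :
  closed_operator A -> symmetric_operator A ->
  bounded_operator B -> positive_operator (graph B) ->
  normal_operator (A *o graph B) ->
  [/\ graph B *o A `<=` A *o graph B /\ self_adjoint (A *o graph B),
      self_adjoint (op_closure (graph B *o A)),
      [/\ graph B *o abs_op A `<=` abs_op A *o graph B,
          self_adjoint (abs_op A *o graph B) &
          positive_operator (abs_op A *o graph B)] &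
      abs_op A *o graph B = op_closure (graph B *o abs_op A)].
Proof.
move=> cA sA /bounded_operator_map Bb /graph_positive[Bs Bp] nN.
have [oA dA symA] := sA; have [dN cN _] := nN.
have eN := normal_comp_self_adjoint sA Bs Bp Bb (linear_imul B) nN.
have sN : self_adjoint (A *o graph B) by split=> //; apply: comp_operator.
have BA x y : A (x, y) -> A (B x, B y).
  move=> Axy; apply/comp_graphE; rewrite eN.
  apply/(adjoint_dotRP (operator_linear (comp_operator B oA))) => u v /comp_graphE Auv.
  by rewrite -Bs; apply: adjoint_dotR Auv; apply: symA.
have [sP pP PP] := abs_opP cA dA; have [_ dP _] := sP.
have BP : forall x y, abs_op A (x, y) -> abs_op A (B x, B y).
  by apply: (modulus_invariant Bb Bs BA sP pP oA PP) => // S _ SB x; rewrite SB.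
have sPB := self_adjoint_comp Bb Bs sP BP.
split.
- by split; [exact: comp_sub|].
- by rewrite comp_closure.
- split=> //; first exact: comp_sub.
  exact: (modulus_comp_positive Bb Bs BA sP pP oA PP).
- rewrite comp_closure //; exact: self_adjoint_closed.
Qed.
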